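(* Consider a Lagrangian control system $$\dot q^i = v^i,\qquad \dot v^i = f^i(q,v,u),\qquad i=1,\dots,p,$$ with $2p$-dimensional classical state $(q,v)$, $m$-dimensional input $u$, a flat output $y=\varphi(q,v,u,u_{[1]},\ldots)$, and the corresponding parameterization $$q = F_q(y_{[0,R-2]}),\qquad v = F_v(y_{[0,R-1]}),\qquad u = F_u(y_{[0,R]}).$$ Let $\kappa=(\kappa^1,\dots,\kappa^m)$ be a multi-index with $\kappa\le R$ and $\#\kappa=\sum_{j=1}^m\kappa^j=2p$. Then the $m$-tuple of time derivatives $y_{[\kappa]}=\varphi_{[\kappa]}(q,v,u,u_{[1]},\ldots)$ of this flat output can be introduced as new input $w$ by a quasi-static feedback law $$u=\alpha(q,v,w,w_{[1]},\ldots)$$ of the classical state $(q,v)$ if and only if the $2p\times 2p$ Jacobian matrix $$\partial_{y_{[0,\kappa-1]}}\begin{pmatrix}F_q\\ F_v\end{pmatrix}$$ is regular.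
   Context: Notation. All objects are smooth and all statements are local. Subscripts in square brackets denote time derivatives: $y^j_{[\alpha]}$ is the $\alpha$-th time derivative of $y^j$. For multi-indices $A=(a^1,\dots,a^m)$, $B=(b^1,\dots,b^m)$ and an integer $c$: $A\pm c=(a^1\pm c,\dots,a^m\pm c)$; $A\le B$ means $a^j\le b^j$ for all $j$; $\#A=\sum_j a^j$; $y_{[A]}=(y^1_{[a^1]},\dots,y^m_{[a^m]})$; $y_{[0,A]}=(y^1_{[0,a^1]},\dots,y^m_{[0,a^m]})$ with $y^j_{[0,a^j]}=(y^j,y^j_{[1]},\dots,y^j_{[a^j]})$ (empty if $a^j<0$). $\partial_z F$ denotes the Jacobian matrix of $F$ with respect to the variables $z$. The functions $F_q,F_v$ are regarded as functions of the independent coordinates $y^j_{[\alpha]}$. Regular means invertible. Lagrangian control system. The configuration space is a $p$-dimensional smooth manifold $\mathcal Q$ with local coordinates $q=(q^1,\dots,q^p)$. The Lagrangian $L(q,\dot q)$ is kinetic minus potential energy, and the external forces enter through a matrix $G(q)$ multiplying the control inputs $u=(u^1,\dots,u^m)$: $$\frac{\mathrm d}{\mathrm dt}\Big(\frac{\partial L}{\partial \dot q^i}\Big)-\frac{\partial L}{\partial q^i}=\sum_{j=1}^m G_{ij}(q)u^j,\qquad i=1,\dots,p.$$ Solving for $\ddot q$ gives the state-space form $\dot q=v$, $\dot v=f(q,v,u)$ with classical state $(q,v)$. Flatness. A system $\dot x=f(x,u)$ with $\dim x=n$, $\dim u=m$ is flat if there is an $m$-tuple of smooth functions $y^j=\varphi^j(x,u,u_{[1]},\ldots)$,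 $j=1,\dots,m$, depending on finitely many time derivatives of $u$ (defined on a state-input manifold with coordinates $(x,u,u_{[1]},\dots,u_{[l_u]})$, $l_u$ large enough), and smooth functions $F_x^i,F_u^j$ such that locally $x^i=F_x^i(y_{[0,R-1]})$ and $u^j=F_u^j(y_{[0,R]})$ for some multi-index $R=(r^1,\dots,r^m)$. Then $y$ is a flat output and these relations are the parameterizing map. The differentials $\mathrm d\varphi,\mathrm d\varphi_{[1]},\dots,\mathrm d\varphi_{[\beta]}$ are linearly independent for every $\beta$, and the parameterizing map is unique with a minimal multi-index $R$, where $r^j$ is the highest order of time derivative of $y^j$ required for expressing $x$ and $u$ by $y$ and its time derivatives; $R$ always denotes this minimal multi-index. Here $x=(q,v)$, $n=2p$, $F_x=(F_q,F_v)$, and for Lagrangian control systems $F_q$ depends on time derivatives of $y$ up to order $R-2$ only. Quasi-static feedback. A quasi-static feedback law of the classical state is an endogenous feedback law $u=\alpha(q,v,w,w_{[1]},\ldots)$ that may contain finitely many time derivatives of the new input $w=(w^1,\dots,w^m)$ and does not increase the order of the closed-loop dynamics (no additional controller states). That $y_{[\kappa]}$ can be introduced as new input $w$ by such a feedback means that the closed-loop system $\dot q=v$, $\dot v=f(q,v,\alpha(q,v,w,w_{[1]},\ldots))$ has the linear input-output behavior $y^j_{[\kappa^j]}=w^j$, $j=1,\dots,m$, between the (freely choosable) new input $w$ and the flat output $y$. Standing assumption. The flat parameterization is well defined locally around equilibrium points (constant states and inputs, parameterized by a constant value $y_s$ of the flat output with all time derivatives of $y$ equal to zero). *)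

(* Defs.v *)
From mathcomp Require Import all_boot all_order all_algebra.
From mathcomp Require Import all_classical all_reals all_analysis.

Set Implicit Arguments.
Unset Strict Implicit.
Unset Printing Implicit Defensive.

Import Order.TTheory GRing.Theory Num.Theory.
Import numFieldNormedType.Exports.

Local Open Scope classical_set_scope.
Local Open Scope ring_scope.

(* A point of a coordinate space is a family of real coordinates indexed by I.
   For infinite I (jet spaces) the topology must be the product one, so that a
   neighbourhood restricts only finitely many coordinates; for finite I it is
   the Euclidean topology. *)
Notation coord_space R I := {ptws I -> R}.

Section Calculus.
Variables (R : realType) (I : eqType).

Definition partial (i : I) (F : coord_space R I -> R) : coord_space R I -> R :=
  fun x => derive1 (fun t : R => F (dfwith x i t)) (x i).

Definition partials (s : seq I) (F : coord_space R I -> R) :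
    coord_space R I -> R :=
  foldr partial F s.

(* Smooth on the open set U: all iterated partial derivatives, in any order,
   exist and are continuous. *)
Definition smooth_on (U : set (coord_space R I)) (F : coord_space R I -> R) :
    Prop :=
  forall s : seq I, forall x : coord_space R I, U x ->
    {for x, continuous (partials s F)} /\
    forall i : I, derivable (fun t : R => partials s F (dfwith x i t)) (x i) 1.

Definition depends_only_on (P : pred I) (U : set (coord_space R I))
    (F : coord_space R I -> R) : Prop :=
  forall x y : coord_space R I, U x -> U y ->
    (forall i : I, P i -> x i = y i) -> F x = F y.

(* Germ at x0 of a smooth function of the coordinates in P. *)
Definition smooth_at (P : pred I) (x0 : coord_space R I)
    (F : coord_space R I -> R) : Prop :=
  exists U : set (coord_space R I),
    [/\ open U, U x0, depends_only_on P U F & smooth_on U F].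

End Calculus.

(* Derivative of F at x in the direction d; for a smooth function of finitely
   many coordinates this is \sum_i d_i * (partial i F)(x). *)
Definition dirderiv (R : realType) (I : Type) (F : coord_space R I -> R)
    (d x : coord_space R I) : R :=
  derive1 (fun t : R => F (fun i => x i + t * d i)) 0.

Section Systems.
Variables (R : realType) (n m : nat).

(* Coordinates (x, u): inl i is x^i and inr j is u^j. *)
Definition state_input : Type := coord_space R ('I_n + 'I_m)%type.

(* Coordinates (x, u, u_[1], u_[2], ...): inl i is x^i, inr (k, j) is u^j_[k]. *)
Definition jet_coord : Type := ('I_n + nat * 'I_m)%type.
Definition jet : Type := coord_space R jet_coord.

(* Coordinates (y, y_[1], ...): (k, j) is y^j_[k]. *)
Definition output_coord : Type := (nat * 'I_m)%type.
Definition output_jet : Type := coord_space R output_coord.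

Definition up_to_order (l : nat) : pred ('I_n + nat * 'I_m)%type :=
  fun c => if c is inr (k, _) then (k <= l)%N else true.

(* The multi-index R enters y_[0,R-c] through alpha + c <= r^j, which agrees with
   alpha <= r^j - c without truncated subtraction. *)
Definition below (r : 'I_m -> nat) (c : nat) : pred (nat * 'I_m)%type :=
  fun a => (a.1 + c <= r a.2)%N.

Definition pair_point (x : 'I_n -> R) (u : 'I_m -> R) : state_input :=
  fun c => match c with inl i => x i | inr j => u j end.

Definition constant_jet (x : 'I_n -> R) (u : 'I_m -> R) : jet :=
  fun c => match c with
           | inl i => x i
           | inr (k, j) => if k == 0%N then u j else 0
           end.

Variable f : 'I_n -> state_input -> R.

Definition equilibrium (x : 'I_n -> R) (u : 'I_m -> R) : Prop :=
  forall i, f i (pair_point x u) = 0.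

(* xdot = f(x, a), where the control a may be any function of x, of an input
   w and of its time derivatives; then d/dt w_[k] = w_[k+1]. *)
Definition vector_field (a : 'I_m -> jet -> R) (z : jet) : jet :=
  fun c => match c with
           | inl i => f i (pair_point (fun i => z (inl i)) (fun j => a j z))
           | inr (k, j) => z (inr (k.+1, j))
           end.

Definition time_deriv (a : 'I_m -> jet -> R) (F : jet -> R) : jet -> R :=
  fun z => dirderiv F (vector_field a z) z.

Definition open_loop : 'I_m -> jet -> R := fun j z => z (inr (0%N, j)).

(* phi_[0], phi_[1], ... as functions of (x, u, u_[1], ...). *)
Definition output_map (phi : 'I_m -> jet -> R) (z : jet) : output_jet :=
  fun c => iter c.1 (time_deriv open_loop) (phi c.2) z.

(* (x, w, w_[1], ...) |-> (x, b, b_[1], ...), the time derivatives being taken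
   along xdot = f(x, a). *)
Definition prolong (a b : 'I_m -> jet -> R) (z : jet) : jet :=
  fun c => match c with
           | inl i => z (inl i)
           | inr (k, j) => iter k (time_deriv a) (b j) z
           end.

Variables (xs : 'I_n -> R) (us : 'I_m -> R).

Definition parameterizing_map (phi : 'I_m -> jet -> R) (r : 'I_m -> nat)
    (Fx : 'I_n -> output_jet -> R) (Fu : 'I_m -> output_jet -> R) : Prop :=
  let xi0 := constant_jet xs us in
  let eta0 := output_map phi xi0 in
  [/\ forall i, smooth_at (below r 1) eta0 (Fx i),
      forall j, smooth_at (below r 0) eta0 (Fu j),
      (\forall z \near xi0, forall i, z (inl i) = Fx i (output_map phi z))
    & (\forall z \near xi0, forall j, z (inr (0%N, j)) = Fu j (output_map phi z))].

Definition minimal_parameterizing_map (phi : 'I_m -> jet -> R) (r : 'I_m -> nat)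
    (Fx : 'I_n -> output_jet -> R) (Fu : 'I_m -> output_jet -> R) : Prop :=
  parameterizing_map phi r Fx Fu /\
  forall r' Fx' Fu', parameterizing_map phi r' Fx' Fu' ->
    forall j, (r j <= r' j)%N.

(* Linear independence of d phi, d phi_[1], ..., d phi_[beta] at each point of
   some neighbourhood of z0 (which may depend on beta). *)
Definition independent_differentials (phi : 'I_m -> jet -> R) (z0 : jet) : Prop :=
  forall beta : nat, \forall z \near z0, forall c : 'M[R]_(beta.+1, m),
    (forall i : 'I_n + nat * 'I_m,
       \sum_(k < beta.+1) \sum_(j < m)
         c k j * partial i (fun z' : jet => output_map phi z' (val k, j)) z = 0) ->
    c = 0.

(* y = phi(x, u, ..., u_[lu]) is a flat output around the equilibrium (xs, us),
   with parameterizing map (Fx, Fu) and minimal multi-index r. *)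
Definition flat_output (lu : nat) (phi : 'I_m -> jet -> R) (r : 'I_m -> nat)
    (Fx : 'I_n -> output_jet -> R) (Fu : 'I_m -> output_jet -> R) : Prop :=
  [/\ forall j, smooth_at (up_to_order lu) (constant_jet xs us) (phi j),
      independent_differentials phi (constant_jet xs us)
    & minimal_parameterizing_map phi r Fx Fu].

(* u = alpha(x, w, w_[1], ..., w_[la]) around the constant input w = ws matching
   the equilibrium. The controller has no state of its own; the feedback is
   endogenous, i.e. w = beta(x, u, u_[1], ..., u_[lb]) for some beta with which
   alpha, together with all time derivatives, is mutually inverse. *)
Definition quasi_static_feedback (alpha : 'I_m -> jet -> R) (ws : 'I_m -> R) : Prop :=
  let xi0 := constant_jet xs us in
  let zeta0 := constant_jet xs ws in
  [/\ exists la : nat, forall j, smooth_at (up_to_order la) zeta0 (alpha j),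
      forall j, alpha j zeta0 = us j
    & exists (lb : nat) (beta : 'I_m -> jet -> R),
      [/\ forall j, smooth_at (up_to_order lb) xi0 (beta j),
          (\forall z \near zeta0, forall j,
             beta j (prolong alpha alpha z) = z (inr (0%N, j)))
        & (\forall z \near xi0, forall j,
             alpha j (prolong open_loop beta z) = z (inr (0%N, j)))]].

(* In the closed loop with u = alpha, y^j_[kappa^j] = w^j for all values of
   (x, w, w_[1], ...) near the equilibrium. *)
Definition linear_input_output (phi : 'I_m -> jet -> R) (kappa : 'I_m -> nat)
    (alpha : 'I_m -> jet -> R) (ws : 'I_m -> R) : Prop :=
  \forall z \near constant_jet xs ws, forall j,
    iter (kappa j) (time_deriv alpha)
      (fun z' : jet => phi j (prolong alpha alpha z')) z = z (inr (0%N, j)).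

Definition introducible_as_input (phi : 'I_m -> jet -> R) (kappa : 'I_m -> nat) :
    Prop :=
  exists (alpha : 'I_m -> jet -> R) (ws : 'I_m -> R),
    quasi_static_feedback alpha ws /\ linear_input_output phi kappa alpha ws.

End Systems.

(* Jacobian matrix with respect to y_[0,kappa-1]; the columns are ordered as
   y^1, ..., y^1_[kappa^1-1], ..., y^m, ..., y^m_[kappa^m-1]. *)
Definition output_jacobian (R : realType) (m d : nat) (kappa : 'I_m -> nat)
    (F : 'I_d -> output_jet R m -> R) (eta : output_jet R m) :
    'M[R]_(d, \sum_(j < m) kappa j) :=
  \mxrow_(j < m) \matrix_(i < d, k < kappa j) partial (val k, j) (F i) eta.

Section Lagrangian.
Variables (R : realType) (p m : nat).

Definition stack (T : Type) (a b : 'I_p -> T) : 'I_(p + p) -> T :=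
  fun i => match fintype.split i with inl k => a k | inr k => b k end.

(* In the state x = (q, v), the coordinate q^i has index lshift p i and v^i has
   index rshift p i. *)
Definition positions (x : coord_space R 'I_(p + p)) : coord_space R 'I_p :=
  fun i => x (lshift p i).

Definition velocities (x : coord_space R 'I_(p + p)) : 'rV[R]_p :=
  \row_i x (rshift p i).

(* Kinetic minus potential energy, with mass matrix M. *)
Definition lagrangian (M : coord_space R 'I_p -> 'M[R]_p) (V : coord_space R 'I_p -> R)
    (x : coord_space R 'I_(p + p)) : R :=
  2^-1 * (velocities x *m M (positions x) *m (velocities x)^T) 0 0
  - V (positions x).

Definition euler_lagrange (L : coord_space R 'I_(p + p) -> R)
    (G : coord_space R 'I_p -> 'M[R]_(p, m))
    (x xdot : coord_space R 'I_(p + p)) (u : 'I_m -> R) : Prop :=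
  forall i : 'I_p,
    dirderiv (partial (rshift p i) L) xdot x - partial (lshift p i) L x =
    \sum_(j < m) G (positions x) i j * u j.

(* Right-hand side of qdot = v, vdot = f(q, v, u). *)
Definition second_order (f : 'I_p -> state_input R (p + p) m -> R) :
    'I_(p + p) -> state_input R (p + p) m -> R :=
  stack (fun i z => z (inl (rshift p i))) f.

(* The system qdot = v, vdot = f(q, v, u) is obtained, around (xs, us), by
   solving the Euler-Lagrange equations for the accelerations. *)
Definition lagrangian_control_system (M : coord_space R 'I_p -> 'M[R]_p)
    (V : coord_space R 'I_p -> R) (G : coord_space R 'I_p -> 'M[R]_(p, m))
    (f : 'I_p -> state_input R (p + p) m -> R)
    (xs : 'I_(p + p) -> R) (us : 'I_m -> R) : Prop :=
  let qs : coord_space R 'I_p := positions xs in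
  [/\ (forall i k, smooth_at xpredT qs (fun q => M q i k)) /\
      (\forall q \near qs, (M q)^T = M q /\
         forall v : 'rV[R]_p, v != 0 -> 0 < (v *m M q *m v^T) 0 0),
      smooth_at xpredT qs V,
      forall i j, smooth_at xpredT qs (fun q => G q i j),
      forall i, smooth_at xpredT (pair_point xs us) (f i)
    & \forall z \near pair_point xs us,
        euler_lagrange (lagrangian M V) G
          (fun i => z (inl i)) (fun i => second_order f i z) (fun j => z (inr j))].

End Lagrangian.

(* Main.v *)
(* Let Phi map (x, u, u_[1], ...) to (y, y_[1], ...). Necessity: in closed loop the
   parameterization reads x = Fx(y_[0,kappa-1], w, w_[1], ...), and differentiating
   it by x with w, w_[1], ... fixed exhibits an inverse of the Jacobian.
   Sufficiency: by the inverse function theorem, x = Fx(y) can be solved for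
   y_[0,kappa-1] in terms of x and y_[kappa], y_[kappa+1], ..., and inserting this
   into u = Fu(y) defines alpha. Since the differentials of phi, phi_[1], ... are
   independent, every finite part of Phi is locally onto; this is what makes the
   feedback endogenous, i.e. all of (x, w, w_[1], ...) near the equilibrium come
   from some (x, u, u_[1], ...). *)

Require Import Defs.
From mathcomp Require Import all_boot all_order all_algebra.
From mathcomp Require Import all_classical all_reals all_analysis.
From mathcomp Require Import lra.

Set Implicit Arguments.
Unset Strict Implicit.
Unset Printing Implicit Defensive.

Import Order.TTheory GRing.Theory Num.Theory.
Import numFieldNormedType.Exports.

Local Open Scope classical_set_scope.
Local Open Scope ring_scope.

(** * Smooth functions of finitely many coordinates *)

(** Jet spaces carry the product topology in infinitely many coordinates, so neither a norm nor a
    Fréchet derivative is at hand. Finite dependence replaces them: each function involved is smooth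
    and depends, on a fixed open set, on finitely many coordinates, and maps between jet spaces are
    smooth componentwise. The inverse function theorem is therefore built inside the product space
    from the mean value and intermediate value theorems in one variable, a coordinate at a time; the
    coordinates not solved for ride along as parameters.

    The same infinity shapes the proof that the feedback is endogenous. Each finite block of [Phi]
    is locally onto, but with a radius that depends on the block, so a point (x, w, w_[1], ...) is
    never shown to be exactly the image of some (x, u, u_[1], ...). Each identity to be checked
    involves finitely many coordinates only, and hitting those is enough.

    At the equilibrium all time derivatives vanish. Hence the closed-loop prolongation carries the
    constant jet of (xs, ws) to that of (xs, us), and neighbourhoods of the two points can be
    matched. *)

Section Coordinates.
Variables (R : realType) (I : eqType).
Local Notation E := (coord_space R I).
Implicit Types (x y : E) (i j : I) (F : E -> R) (U : set E).

(* Equal to [nbhs x], by [nbhs_coordE]; spelled out because unifying the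
   structures behind [nbhs] on an infinite product unfolds too much. *)
Definition cnbhs x : set_system E := [set A | exists (s : seq I) (e : R),
  0 < e /\ forall y, (forall i, i \in s -> `|y i - x i| < e) -> A y].

Global Instance cnbhs_filter x : ProperFilter (cnbhs x).
Proof.
split; [|split].
- by move=> [s [e [e0 /(_ x)]]]; apply => i _; rewrite subrr normr0.
- by exists [::], 1; split => //.
- move=> P Q [s [e [e0 sP]]] [t [d [d0 tQ]]].
  exists (s ++ t), (Num.min e d); split; first by rewrite lt_min e0.
  move=> y yst; split; [apply: sP|apply: tQ] => i it;
  have := yst i; rewrite mem_cat it ?orbT lt_min => /(_ erefl) /andP[] //.
- move=> P Q PQ [s [e [e0 sP]]]; exists s, e; split => // y ys.
  by apply: PQ; apply: sP.
Qed.

Lemma cvg_coord i x : (fun y : E => y i) @ cnbhs x --> x i.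
Proof.
apply/cvgrPdist_lt => e e0.
by exists [:: i], e; split => // y /(_ i); rewrite inE eqxx distrC; apply.
Qed.

(** The product topology is the supremum of the topologies pulled back along the coordinates. So a
    neighbourhood contains a finite box as soon as the identity converges coordinatewise along
    [cnbhs x]; conversely, a box is a finite intersection of preimages. *)
Lemma nbhs_coordE x : nbhs x = cnbhs x.
Proof.
rewrite predeqE => A; split; last first.
  move=> [s [e [e0 sA]]].
  have h : nbhs x [set y : E | forall i, i \in s -> `|y i - x i| < e].
    elim: s {sA} => [|i s IH].
      apply: (@filterS _ _ (nbhs_filter x) setT); last first.
        exact: (@filterT _ _ (nbhs_filter x)).
      by move=> y _ i; rewrite in_nil.
    have xi : nbhs x [set y : E | `|y i - x i| < e].
      have xi : (fun y : E => y i) @ nbhs x --> x i.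
        exact: (@proj_continuous I (fun=> R) i x).
      have /cvgrPdist_lt /(_ _ e0) h := xi.
      by apply: filterS h => y /=; rewrite distrC.
    have h := @filterI _ _ (nbhs_filter x) _ _ xi IH.
    apply: (@filterS _ _ (nbhs_filter x) _ _ _ h) => y [yi ys] j.
    by rewrite inE => /orP[/eqP-> //|]; exact: ys.
  exact: (@filterS _ _ (nbhs_filter x) _ _ sA h).
suff : (id : E -> E) @ cnbhs x --> x by move=> h /h.
apply/cvg_sup => i U [/= V [[W oW <-] Wx WU]].
apply: (filterS WU); apply: cvg_coord.
exact: open_nbhs_nbhs.
Qed.

Definition copen U := forall x, U x -> cnbhs x U.

Lemma openP U : open U <-> copen U.
Proof.
rewrite openE; split => oU x /oU; first by rewrite -nbhs_coordE.
by rewrite /interior nbhs_coordE.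
Qed.

Lemma dfwith_id x i : dfwith x i (x i) = x.
Proof. by apply/funext => j; case: dfwithP. Qed.

Lemma dfwith_dfwith x i (a b : R) : dfwith (dfwith x i a) i b = dfwith x i b :> E.
Proof.
apply/funext => j; case: dfwithP; first by rewrite dfwithin.
by move=> k ik; rewrite !dfwithout.
Qed.

(** Convergence in the product topology, stated through real limits only; [ccvg_near] turns it into
    a statement on neighbourhoods. *)
Definition ccvg (T : Type) (g : T -> E) (G : set_system T) x :=
  forall i, g t i @[t --> G] --> x i.

Lemma ccvg_near (T : Type) (G : set_system T) {FG : Filter G} (g : T -> E) x
    (A : set E) : ccvg g G x -> cnbhs x A -> \forall t \near G, A (g t).
Proof.
move=> gx [s [e [e0 sA]]].
suff h : \forall t \near G, forall i, i \in s -> `|g t i - x i| < e.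
  by apply: filterS h => t; exact: sA.
elim: s {sA} => [|i s IH]; first by apply: nearW => y i; rewrite in_nil.
have /cvgrPdist_lt /(_ _ e0) gi := gx i.
near=> t => j; rewrite inE => /orP[/eqP->|js].
  by rewrite distrC; near: t.
by move: j js; near: t.
Unshelve. all: by end_near. Qed.

Lemma ccvg_comp (T : Type) (G : set_system T) {FG : Filter G} (g : T -> E) x F
    (l : R) : ccvg g G x -> F @ cnbhs x --> l -> F (g t) @[t --> G] --> l.
Proof.
by move=> gx Fl A /Fl; rewrite /= => FA; exact: ccvg_near gx FA.
Qed.

Lemma ccvg_dfwith (T : Type) (G : set_system T) {FG : Filter G} (y : T -> E)
    (b : T -> R) x i :
  (forall j, i != j -> y t j @[t --> G] --> x j) -> b @ G --> x i ->
  ccvg (fun t => dfwith (y t) i (b t)) G x.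
Proof.
move=> yx bx j; have [<-|ij] := eqVneq i j.
  by under eq_fun do rewrite dfwithin.
by under eq_fun do rewrite dfwithout//; exact: yx.
Qed.

Definition pderivable i F x := derivable (fun t : R => F (dfwith x i t)) (x i) 1.

Lemma pderivableP i F x :
  pderivable i F x -> is_derive (x i) 1 (fun t : R => F (dfwith x i t)) (partial i F x).
Proof. by move=> dF; rewrite /partial derive1E; apply/derivableP. Qed.

Lemma is_derive_partial i F y (t : R) : pderivable i F (dfwith y i t) ->
  is_derive t 1 (fun u : R => F (dfwith y i u)) (partial i F (dfwith y i t)).
Proof.
move=> /pderivableP; rewrite dfwithin.
by under eq_fun do rewrite dfwith_dfwith.
Qed.

Lemma slice_continuous F y i (a b : R) :
  (forall t, a <= t <= b -> pderivable i F (dfwith y i t)) ->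
  {within `[a, b], continuous (fun t => F (dfwith y i t))}.
Proof.
move=> dF; apply: derivable_within_continuous => t; rewrite in_itv/= => tab.
by have [] := is_derive_partial (dF _ tab).
Qed.

(** The end points are left unordered because in later uses both move with a parameter and may
    cross. *)
Lemma partial_MVT i F y (a b : R) :
  (forall t, Num.min a b <= t <= Num.max a b -> pderivable i F (dfwith y i t)) ->
  exists2 c, Num.min a b <= c <= Num.max a b &
    F (dfwith y i b) - F (dfwith y i a) = partial i F (dfwith y i c) * (b - a).
Proof.
wlog ab : a b / a <= b.
  move=> wl dF; have /orP[ab|ba] := le_total a b; first exact: wl.
  have [|c cba e] := wl b a ba; first by rewrite minC maxC.
  exists c; first by rewrite minC maxC.
  by rewrite -opprB e -mulrN opprB.
rewrite (min_idPl ab) (max_idPr ab) => dF.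
have [||c + e] := @MVT_segment R (fun t => F (dfwith y i t))
  (fun t => partial i F (dfwith y i t)) _ _ ab.
- move=> t; rewrite in_itv/= => /andP[/ltW ta /ltW tb].
  by apply/is_derive_partial/dF; rewrite ta.
- exact: slice_continuous.
by rewrite in_itv/= => cab; exists c.
Qed.

(** The substitute for Fréchet differentiability: by the mean value theorem an increment along one
    coordinate factors through a slope [Q], and continuity of the partial derivative gives the limit
    of [Q] even though the base point [y t] moves. *)
Lemma slope_cvg (T : Type) (G : set_system T) {FG : Filter G} (y : T -> E)
    (b : T -> R) x i F :
  cnbhs x (pderivable i F) -> partial i F @ cnbhs x --> partial i F x ->
  ccvg y G x -> b @ G --> x i ->
  exists2 Q : T -> R, Q @ G --> partial i F x &
    \forall t \near G, F (dfwith (y t) i (b t)) - F (y t) = Q t * (b t - y t i).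
Proof.
move=> [s [e [e0 sF]]] cF yx bx.
pose P t c := (Num.min (y t i) (b t) <= c <= Num.max (y t i) (b t)) /\
  F (dfwith (y t) i (b t)) - F (y t) = partial i F (dfwith (y t) i c) * (b t - y t i).
(* The intermediate point, chosen for each [t]; the default [x i] occurs only where the mean value
   theorem does not apply, which [Pc] excludes for [t] near the limit. *)
pose c t := xget (x i) (P t).
have near_i (f : T -> R) d : 0 < d -> f @ G --> x i ->
    \forall t \near G, `|f t - x i| < d.
  move=> d0 /cvgrPdist_lt /(_ _ d0) h; apply: filterS h => t.
  by rewrite distrC.
have Pc : \forall t \near G, P t (c t).
  have ys : \forall t \near G, forall j, j \in s -> `|y t j - x j| < e.
    apply: (ccvg_near (A := [set z | forall j, j \in s -> `|z j - x j| < e]) yx).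
    by exists s, e; split.
  near=> t.
  suff /(xgetPex (x i)) : exists k, P t k by [].
  have [|k ck ek] := @partial_MVT i F (y t) (y t i) (b t); last first.
    by exists k; split => //; rewrite -ek dfwith_id.
  move=> k kab; apply: sF => j js.
  have [<-|ij] := eqVneq i j; last first.
    by rewrite dfwithout//; move: j js {ij}; near: t.
  rewrite dfwithin.
  have h1 : `|y t i - x i| < e by near: t; exact: near_i.
  have h2 : `|b t - x i| < e by near: t; exact: near_i.
  by move: kab h1 h2; rewrite ge_min le_max !ltr_norml; lra.
have cx : c @ G --> x i.
  apply/cvgrPdist_lt => d d0; near=> t.
  have h1 : `|y t i - x i| < d by near: t; exact: near_i.
  have h2 : `|b t - x i| < d by near: t; exact: near_i.
  have [+ _] : P t (c t) by near: t.
  by move: h1 h2; rewrite ge_min le_max !ltr_norml; lra.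
exists (fun t => partial i F (dfwith (y t) i (c t))); last first.
  by apply: filterS Pc => t [].
by apply: ccvg_comp cF; apply: ccvg_dfwith.
Unshelve. all: by end_near. Qed.

End Coordinates.

(** * Derivatives of functions of one real variable *)

Lemma is_derive1P (R : realType) (h : R -> R) (t d : R) :
  is_derive t 1 h d <-> u^-1 * (h (u + t) - h t) @[u --> 0^'] --> d.
Proof.
have E : (fun u : R => u^-1 *: ((h \o shift t) (u *: 1) - h t)) =
         (fun u => u^-1 * (h (u + t) - h t)).
  by apply/funext => u; rewrite /= /GRing.scale/= mulr1.
split=> [[/cvg_ex[l hl] <-]|hd].
  by rewrite /derive E; rewrite E in hl; rewrite (cvg_lim _ hl).
split; first by rewrite /derivable E; apply/cvg_ex; exists d.
by rewrite /derive E; exact: cvg_lim.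
Qed.

(** Carathéodory's form of the chain rule: the increment of [k] is never divided by, so it may
    vanish arbitrarily close to [t]. *)
Lemma is_derive_slope (R : realType) (h k Q : R -> R) (t q dk : R) :
  is_derive t 1 k dk -> Q u @[u --> t] --> q ->
  (\forall u \near t, h u - h t = Q u * (k u - k t)) ->
  is_derive t 1 h (q * dk).
Proof.
move=> /is_derive1P kd Qq hk; apply/is_derive1P.
have tr : (fun u : R => u + t) @ 0^' --> t.
  apply: cvg_within_filter; have : (fun u : R => u + t) @ nbhs 0 --> 0 + t.
    by apply: cvgD; [exact: cvg_id|exact: cvg_cst].
  by rewrite add0r.
have Q0 : Q (u + t) @[u --> 0^'] --> q by exact: cvg_comp tr Qq.
apply: (cvg_trans _ (cvgM Q0 kd)); apply: near_eq_cvg.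
have {}hk : \forall u \near 0^', h (u + t) - h t = Q (u + t) * (k (u + t) - k t).
  exact: tr hk.
by apply: filterS hk => u /= ->; rewrite mulrCA.
Qed.

Lemma is_derive_cvg (R : realType) (h : R -> R) (t d : R) :
  is_derive t 1 h d -> h u @[u --> t] --> h t.
Proof.
by move=> [/derivable1_diffP hd _]; exact: differentiable_continuous hd.
Qed.

Lemma derive1_near_cst (R : realType) (f : R -> R) (a c : R) :
  (\forall t \near a, f t = c) -> derive1 f a = 0.
Proof.
move=> fc; rewrite derive1E (near_eq_derive 1 (f := f) (g := cst c)) //.
exact: derive_cst.
Qed.

Lemma derive1_congr (R : realType) (f g : R -> R) (a : R) :
  (\forall t \near a, f t = g t) -> derive1 f a = derive1 g a.
Proof. by move=> fg; rewrite !derive1E; exact: near_eq_derive. Qed.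

(** * Chain rule along curves and differentiability classes *)

Section Chain.
Variables (R : realType) (I : eqType).
Local Notation E := (coord_space R I).
Implicit Types (x y : E) (i j : I) (F : E -> R) (U : set E) (s : seq I).

Lemma chain_curve U F s (g : R -> E) (dg : I -> R) (t : R) :
  copen U -> U (g t) -> uniq s -> depends_only_on (fun i => i \in s) U F ->
  (forall i, cnbhs (g t) (pderivable i F)) ->
  (forall i, partial i F @ cnbhs (g t) --> partial i F (g t)) ->
  (forall i, is_derive t 1 (fun u => g u i) (dg i)) ->
  is_derive t 1 (fun u => F (g u)) (\sum_(i <- s) partial i F (g t) * dg i).
Proof.
move=> oU Ugt us depF dF cF gd.
have gc i := is_derive_cvg (gd i).
pose v s' u : E := fun j => if j \in s' then g u j else g t j.
have vt s' : v s' t = g t by apply/funext => j; rewrite /v if_same.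
have vc s' : ccvg (v s') (nbhs t) (g t).
  move=> j; rewrite /v; have [_|_] := boolP (j \in s'); first exact: gc.
  exact: cvg_cst.
suff H s' : uniq s' ->
    is_derive t 1 (fun u => F (v s' u)) (\sum_(i <- s') partial i F (g t) * dg i).
  apply: near_eq_is_derive (H s us).
  have Uv : \forall u \near t, U (v s u) by apply: ccvg_near (vc s) _; exact: oU.
  have Ug : \forall u \near t, U (g u) by apply: (ccvg_near gc); exact: oU.
  near=> u; apply: depF; [by near: u..|].
  by move=> i si; rewrite /v si.
elim: s' => [_|i s' IH /=/andP[is' us']].
  by rewrite big_nil; exact: (is_derive_cst (F (g t))).
rewrite big_cons.
have vS u : v (i :: s') u = dfwith (v s' u) i (g u i).
  apply/funext => j; rewrite /v inE eq_sym; case: eqVneq => [<-|ij] /=.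
    by rewrite dfwithin.
  by rewrite dfwithout.
have -> : (fun u => F (v (i :: s') u)) =
    (fun u => F (dfwith (v s' u) i (g u i)) - F (v s' u)) + (fun u => F (v s' u)).
  by apply/funext => u; rewrite vS fctE subrK.
apply: is_deriveD; last exact: IH.
have [Q Qc Qn] := slope_cvg (dF i) (cF i) (vc s') (gc i).
apply: (is_derive_slope (gd i) Qc).
apply: filterS Qn => u ->.
rewrite !vt dfwith_id subrr subr0; congr (_ * (_ - _)).
by rewrite /v (negbTE is').
Unshelve. all: by end_near. Qed.

Lemma near_dfwith U x i : copen U -> U x -> \forall t \near x i, U (dfwith x i t).
Proof.
move=> oU Ux; apply: (ccvg_near (G := nbhs (x i)) (g := fun t : R => dfwith x i t) _ (oU x Ux)).
apply: ccvg_dfwith; last exact: cvg_id.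
by move=> j _; exact: cvg_cst.
Qed.

Lemma pderivable_congr U F F' x i : copen U -> (forall y, U y -> F y = F' y) ->
  U x -> pderivable i F x -> pderivable i F' x.
Proof.
move=> oU FF' Ux; apply: near_eq_derivable.
by apply: filterS (near_dfwith i oU Ux) => t; exact: FF'.
Qed.

Lemma partial_congr U F F' x i : copen U -> (forall y, U y -> F y = F' y) ->
  U x -> partial i F x = partial i F' x.
Proof.
move=> oU FF' Ux; apply: derive1_congr.
by apply: filterS (near_dfwith i oU Ux) => t; exact: FF'.
Qed.

(** For [i] outside [P] both values are zero, since [F] is then locally constant along the
    coordinate [i]. *)
Lemma depends_partial P U F i : copen U -> depends_only_on P U F ->
  depends_only_on P U (partial i F).
Proof.
move=> oU depF x y Ux Uy xy; rewrite /partial.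
have [Pi|nPi] := boolP (P i).
  rewrite (xy i Pi); apply: derive1_congr.
  have nx := near_dfwith i oU Ux; rewrite (xy i Pi) in nx.
  have ny := near_dfwith i oU Uy.
  near=> t; apply: depF; [by near: t..|] => j Pj.
  by have [<-|ij] := eqVneq i j; [rewrite !dfwithin|rewrite !dfwithout ?xy].
have D0 z : U z -> derive1 (fun t : R => F (dfwith z i t)) (z i) = 0.
  move=> Uz; apply: (@derive1_near_cst _ _ _ (F z)).
  have nz := near_dfwith i oU Uz.
  near=> t; apply: depF => //; first by near: t.
  move=> j Pj; rewrite dfwithout//; by apply: contraNneq nPi => ->.
by rewrite !D0.
Unshelve. all: by end_near. Qed.

Lemma partial_out P U F i x : copen U -> depends_only_on P U F -> U x -> ~~ P i ->
  partial i F x = 0.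
Proof.
move=> oU depF Ux nPi; apply: (@derive1_near_cst _ _ _ (F x)).
have nx := near_dfwith i oU Ux.
near=> t; apply: depF => //; first by near: t.
move=> j Pj; rewrite dfwithout//; by apply: contraNneq nPi => ->.
Unshelve. all: by end_near. Qed.

(** Recursion on the order, where [smooth_on] quantifies over lists of indices, allows closure
    properties to be proved by induction and functions to be treated whose smoothness is known only
    up to some order. *)
Fixpoint Ck (n : nat) U F : Prop :=
  (forall x, U x -> F @ cnbhs x --> F x) /\
  if n is n'.+1 then (forall x i, U x -> pderivable i F x) /\
    forall i, Ck n' U (partial i F) else True.

Lemma Ck_cvg n U F x : Ck n U F -> U x -> F @ cnbhs x --> F x.
Proof. by case: n => [|n] [+ _]; exact. Qed.

Lemma CkS n U F : Ck n.+1 U F -> Ck n U F.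
Proof.
elim: n F => [|n IH] F [cF [dF pF]]; first by split.
by split => //; split => // i; exact/IH/pF.
Qed.

Lemma Ck_congr n U F F' : copen U -> (forall y, U y -> F y = F' y) ->
  Ck n U F -> Ck n U F'.
Proof.
move=> oU; elim: n F F' => [|n IH] F F' FF'.
  move=> [cF _]; split=> // x Ux; rewrite -FF'//.
  apply: cvg_trans (cF x Ux); apply: near_eq_cvg.
  by apply: filterS (oU x Ux) => y Uy; rewrite FF'.
move=> [cF [dF pF]]; split; [|split].
- move=> x Ux; rewrite -FF'//; apply: cvg_trans (cF x Ux); apply: near_eq_cvg.
  by apply: filterS (oU x Ux) => y Uy; rewrite FF'.
- by move=> x i Ux; apply: (pderivable_congr oU FF' Ux); exact: dF.
- by move=> i; apply: IH (pF i) => y Uy; exact: partial_congr oU FF' Uy.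
Qed.

Lemma Ck_sub n U V F : V `<=` U -> Ck n U F -> Ck n V F.
Proof.
move=> VU; elim: n F => [|n IH] F.
  by move=> [cF _]; split => // x /VU; exact: cF.
move=> [cF [dF pF]]; split; first by move=> x /VU; exact: cF.
by split => [x i /VU|i]; [exact: dF|exact/IH/pF].
Qed.

Lemma is_partial F x i d : is_derive (x i) 1 (fun t => F (dfwith x i t)) d ->
  pderivable i F x /\ partial i F x = d.
Proof. by move=> [dF dE]; split; [exact: dF|rewrite /partial derive1E]. Qed.

Lemma is_partial_cst (a : R) x i :
  pderivable i (cst a) x /\ partial i (cst a) x = 0.
Proof. by apply: (@is_partial (cst a)); exact: is_derive_cst. Qed.

Lemma is_partial_coord x i j :
  pderivable i (fun y => y j) x /\ partial i (fun y => y j) x = (i == j)%:R.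
Proof.
apply: (@is_partial (fun y => y j)); case: eqVneq => [<-|ij].
  by under eq_fun do rewrite dfwithin; exact: is_derive_id.
by under eq_fun do rewrite dfwithout//; exact: is_derive_cst.
Qed.

Lemma partial_coord i j : partial i (fun x => x j) = cst (i == j)%:R.
Proof. by apply/funext => x; have [] := is_partial_coord x i j. Qed.

Lemma Ck_cst n U (a : R) : Ck n U (cst a).
Proof.
elim: n a => [|n IH] a; first by split => // x _; exact: cvg_cst.
split; first by move=> x _; exact: cvg_cst.
split=> [x i _|i]; first by have [] := is_partial_cst a x i.
rewrite (_ : partial i _ = cst 0)//; apply/funext => x.
by have [] := is_partial_cst a x i.
Qed.

Lemma Ck_coord n U j : Ck n U (fun x => x j).
Proof.
case: n => [|n]; first by split => // x _; exact: cvg_coord.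
split; first by move=> x _; exact: cvg_coord.
split=> [x i _|i]; first by have [] := is_partial_coord x i j.
by rewrite partial_coord; exact: Ck_cst.
Qed.

Lemma is_partialD F G x i : pderivable i F x -> pderivable i G x ->
  pderivable i (fun y => F y + G y) x /\
  partial i (fun y => F y + G y) x = partial i F x + partial i G x.
Proof.
move=> /pderivableP dF /pderivableP dG.
apply: (@is_partial (fun y => F y + G y)); exact: is_deriveD.
Qed.

Lemma is_partialM F G x i : pderivable i F x -> pderivable i G x ->
  pderivable i (fun y => F y * G y) x /\
  partial i (fun y => F y * G y) x = F x * partial i G x + partial i F x * G x.
Proof.
move=> /pderivableP dF /pderivableP dG; apply: (@is_partial (fun y => F y * G y)).
apply: (is_derive_eq (is_deriveM dF dG)).
by rewrite !dfwith_id /GRing.scale/= [partial i F x * _]mulrC.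
Qed.

Lemma is_partialV F x i : pderivable i F x -> F x != 0 ->
  pderivable i (fun y => (F y)^-1) x /\
  partial i (fun y => (F y)^-1) x = - (partial i F x * ((F x)^-1 * (F x)^-1)).
Proof.
move=> /pderivableP dF F0; apply: (@is_partial (fun y => (F y)^-1)).
have F0' : F (dfwith x i (x i)) != 0 by rewrite dfwith_id.
apply: (is_derive_eq (is_deriveV F0' dF)).
rewrite dfwith_id /GRing.scale/= mulNr mulrC exprS expr1 invfM //.
Qed.

Lemma CkD n U F G : copen U -> Ck n U F -> Ck n U G -> Ck n U (fun x => F x + G x).
Proof.
move=> oU; elim: n F G => [|n IH] F G.
  move=> [cF _] [cG _]; split => // x Ux; apply: cvgD; [exact: cF|exact: cG].
move=> [cF [dF pF]] [cG [dG pG]]; split; [|split].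
- by move=> x Ux; apply: cvgD; [exact: cF|exact: cG].
- by move=> x i Ux; have [] := is_partialD (dF x i Ux) (dG x i Ux).
- move=> i; apply: Ck_congr oU _ (IH _ _ (pF i) (pG i)) => x Ux.
  by have [] := is_partialD (dF x i Ux) (dG x i Ux).
Qed.

Lemma CkM n U F G : copen U -> Ck n U F -> Ck n U G -> Ck n U (fun x => F x * G x).
Proof.
move=> oU; elim: n F G => [|n IH] F G.
  move=> [cF _] [cG _]; split => // x Ux; apply: cvgM; [exact: cF|exact: cG].
move=> CF CG; case: (CF) (CG) => [cF [dF pF]] [cG [dG pG]]; split; [|split].
- by move=> x Ux; apply: cvgM; [exact: cF|exact: cG].
- by move=> x i Ux; have [] := is_partialM (dF x i Ux) (dG x i Ux).
- move=> i; have C := CkD oU (IH _ _ (CkS CF) (pG i)) (IH _ _ (pF i) (CkS CG)).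
  apply: Ck_congr oU _ C => x Ux.
  by have [] := is_partialM (dF x i Ux) (dG x i Ux).
Qed.

Lemma CkN n U F : copen U -> Ck n U F -> Ck n U (fun x => - F x).
Proof.
move=> oU CF; apply: Ck_congr oU _ (CkM oU (Ck_cst n U (-1)) CF) => x _.
by rewrite /= mulN1r.
Qed.

Lemma CkV n U F : copen U -> (forall x, U x -> F x != 0) -> Ck n U F ->
  Ck n U (fun x => (F x)^-1).
Proof.
move=> oU F0; elim: n => [|n IH].
  by move=> [cF _]; split => // x Ux; apply: cvgV; [exact: F0|exact: cF].
move=> CF; case: (CF) => [cF [dF pF]]; split; [|split].
- by move=> x Ux; apply: cvgV; [exact: F0|exact: cF].
- by move=> x i Ux; have [] := is_partialV (dF x i Ux) (F0 x Ux).
- move=> i; have C := IH (CkS CF).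
  apply: Ck_congr oU _ (CkN oU (CkM oU (pF i) (CkM oU C C))) => x Ux.
  by have [] := is_partialV (dF x i Ux) (F0 x Ux).
Qed.

Lemma Ck_sum (J : Type) (r : seq J) (P : pred J) n U (F : J -> E -> R) : copen U ->
  (forall k, P k -> Ck n U (F k)) -> Ck n U (fun x => \sum_(k <- r | P k) F k x).
Proof.
move=> oU CF; elim: r => [|k r IH].
  by apply: (Ck_congr oU _ (Ck_cst n U 0)) => x _; rewrite big_nil.
have [Pk|nPk] := boolP (P k); last first.
  by apply: (Ck_congr oU _ IH) => x _; rewrite big_cons (negbTE nPk).
apply: (Ck_congr oU _ (CkD oU (CF _ Pk) IH)) => x _.
by rewrite big_cons Pk.
Qed.

Lemma smooth_onP U F : smooth_on U F <-> forall n, Ck n U F.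
Proof.
split=> [sF n|CF].
  elim: n F sF => [|n IH] F sF.
    split => // x Ux; have [+ _] := sF [::] x Ux.
    by rewrite -nbhs_coordE.
  split; [|split].
  - by move=> x Ux; have [+ _] := sF [::] x Ux; rewrite -nbhs_coordE.
  - by move=> x i Ux; have [_ /(_ i)] := sF [::] x Ux.
  (* [foldr] applies the last index of the list first, so the derivatives of [partial i F] along [s]
     are those of [F] along [rcons s i]. *)
  - by move=> i; apply: IH => s x Ux; have := sF (rcons s i) x Ux;
      rewrite /partials foldr_rcons.
suff H s : forall n, Ck n U (partials s F).
  move=> s x Ux; split.
    suff : partials s F @ nbhs x --> partials s F x by [].
    by rewrite nbhs_coordE; exact: Ck_cvg (H s 0) Ux.
  by move=> i; have [_ [+ _]] := H s 1; exact.
by elim: s => [|i s IH] n //=; have [_ [_ ]] := IH n.+1; exact.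
Qed.

End Chain.

(** * Smooth functions and maps with finite dependence *)

Section Smooth.
Variables (R : realType) (I : eqType).
Local Notation E := (coord_space R I).
Implicit Types (x y : E) (i : I) (F G : E -> R) (U W : set E) (s : seq I).

(** The finite list is kept next to smoothness because it is the index set of the sum in the chain
    rule. *)
Definition fsmooth U F := (forall n, Ck n U F) /\
  exists s, depends_only_on (fun i => i \in s) U F.

Lemma chain_rule U F s (g : R -> E) (dg : I -> R) (t : R) :
  copen U -> Ck 1 U F -> uniq s -> depends_only_on (fun i => i \in s) U F ->
  U (g t) -> (forall i, is_derive t 1 (fun u => g u i) (dg i)) ->
  is_derive t 1 (fun u => F (g u)) (\sum_(i <- s) partial i F (g t) * dg i).
Proof.
move=> oU [_ [dF pF]] us depF Ug gd.
apply: (chain_curve oU Ug us depF _ _ gd) => i.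
  by apply: filterS (oU _ Ug) => y; exact: dF.
by have [cF _] := pF i; exact: cF.
Qed.

Lemma depends_sub (P Q : pred I) U W F : (forall i, P i -> Q i) -> W `<=` U ->
  depends_only_on P U F -> depends_only_on Q W F.
Proof.
move=> PQ WU depF x y /WU Ux /WU Uy xy; apply: depF => // i /PQ; exact: xy.
Qed.

Lemma fsmooth_sub U W F : W `<=` U -> fsmooth U F -> fsmooth W F.
Proof.
move=> WU [CF [s depF]]; split=> [n|]; first exact: Ck_sub WU (CF n).
by exists s; exact: depends_sub depF.
Qed.

Lemma fsmooth_congr U F G : copen U -> (forall x, U x -> F x = G x) ->
  fsmooth U F -> fsmooth U G.
Proof.
move=> oU FG [CF [s depF]]; split=> [n|]; first exact: Ck_congr oU FG (CF n).
by exists s => x y Ux Uy xy; rewrite -!FG//; exact: depF.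
Qed.

Lemma fsmooth_uniq U F : fsmooth U F ->
  exists2 s, uniq s & depends_only_on (fun i => i \in s) U F.
Proof.
move=> [_ [s depF]]; exists (undup s); first exact: undup_uniq.
by apply: depends_sub depF => // i; rewrite mem_undup.
Qed.

Lemma fsmooth_cst U a : fsmooth U (cst a).
Proof. by split=> [n|]; [exact: Ck_cst|exists [::]]. Qed.

Lemma fsmooth_coord U i : fsmooth U (fun x => x i).
Proof.
split=> [n|]; first exact: Ck_coord.
by exists [:: i] => x y _ _; apply; rewrite inE.
Qed.

Lemma depends2 U F G : (exists s, depends_only_on (fun i => i \in s) U F) ->
  (exists s, depends_only_on (fun i => i \in s) U G) ->
  exists s, forall x y, U x -> U y -> (forall i, i \in s -> x i = y i) ->
    F x = F y /\ G x = G y.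
Proof.
move=> [s dF] [t dG]; exists (s ++ t) => x y Ux Uy xy.
by split; [apply: dF|apply: dG] => // i it; apply: xy; rewrite mem_cat it ?orbT.
Qed.

Lemma fsmoothD U F G : copen U -> fsmooth U F -> fsmooth U G ->
  fsmooth U (fun x => F x + G x).
Proof.
move=> oU [CF dF] [CG dG]; split=> [n|]; first exact: CkD.
have [s h] := depends2 dF dG; exists s => x y Ux Uy xy.
by have [-> ->] := h x y Ux Uy xy.
Qed.

Lemma fsmoothM U F G : copen U -> fsmooth U F -> fsmooth U G ->
  fsmooth U (fun x => F x * G x).
Proof.
move=> oU [CF dF] [CG dG]; split=> [n|]; first exact: CkM.
have [s h] := depends2 dF dG; exists s => x y Ux Uy xy.
by have [-> ->] := h x y Ux Uy xy.
Qed.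

Lemma fsmoothN U F : copen U -> fsmooth U F -> fsmooth U (fun x => - F x).
Proof.
move=> oU [CF [s dF]]; split=> [n|]; first exact: CkN.
by exists s => x y Ux Uy xy; rewrite (dF x y).
Qed.

Lemma fsmooth_sum (J : Type) (r : seq J) (P : pred J) U (F : J -> E -> R) :
  copen U -> (forall k, P k -> fsmooth U (F k)) ->
  fsmooth U (fun x => \sum_(k <- r | P k) F k x).
Proof.
move=> oU CF; elim: r => [|k r IH].
  by apply: (fsmooth_congr oU _ (fsmooth_cst U 0)) => x _; rewrite big_nil.
have [Pk|nPk] := boolP (P k); last first.
  by apply: (fsmooth_congr oU _ IH) => x _; rewrite big_cons (negbTE nPk).
apply: (fsmooth_congr oU _ (fsmoothD oU (CF _ Pk) IH)) => x _.
by rewrite big_cons Pk.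
Qed.

Lemma fsmooth_prod (J : Type) (r : seq J) (P : pred J) U (F : J -> E -> R) :
  copen U -> (forall k, P k -> fsmooth U (F k)) ->
  fsmooth U (fun x => \prod_(k <- r | P k) F k x).
Proof.
move=> oU CF; elim: r => [|k r IH].
  by apply: (fsmooth_congr oU _ (fsmooth_cst U 1)) => x _; rewrite big_nil.
have [Pk|nPk] := boolP (P k); last first.
  by apply: (fsmooth_congr oU _ IH) => x _; rewrite big_cons (negbTE nPk).
apply: (fsmooth_congr oU _ (fsmoothM oU (CF _ Pk) IH)) => x _.
by rewrite big_cons Pk.
Qed.

Lemma fsmooth_partial U F i : copen U -> fsmooth U F -> fsmooth U (partial i F).
Proof.
move=> oU [CF [s depF]]; split=> [n|]; first by have [_ [_ ]] := CF n.+1; exact.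
by exists s; exact: depends_partial.
Qed.

Lemma fsmooth_cvg U F x : fsmooth U F -> U x -> F @ cnbhs x --> F x.
Proof. by move=> [/(_ 0%N) CF _]; exact: Ck_cvg CF. Qed.

Lemma is_derive_line x (d : E) i : is_derive (0 : R) 1 (fun t => x i + t * d i) (d i).
Proof.
have C : (fun=> d i) @ (0 : R)^' --> d i by exact: cvg_cst.
apply/is_derive1P; apply: (cvg_trans _ C); apply: near_eq_cvg.
have : \forall u \near (0 : R)^', u != 0 by exact: nbhs_dnbhs_neq.
by apply: filterS => u u0; rewrite mul0r !addr0 addrC addKr mulKf.
Qed.

Lemma line0 x (d : E) : (fun i => x i + 0 * d i) = x.
Proof. by apply/funext => i; rewrite mul0r addr0. Qed.

Lemma dirderivE U F s (d x : E) : copen U -> Ck 1 U F -> uniq s ->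
  depends_only_on (fun i => i \in s) U F -> U x ->
  dirderiv F d x = \sum_(i <- s) partial i F x * d i.
Proof.
move=> oU CF us depF Ux; rewrite /dirderiv derive1E.
have Ux' : U (fun i => x i + 0 * d i) by rewrite line0.
have [_] := chain_rule oU CF us depF Ux' (fun i => is_derive_line x d i).
by rewrite line0 => ->.
Qed.

End Smooth.

Section SmoothMaps.
Variables (R : realType).
Implicit Types (I J K : eqType).

(** Each component has its own finite list, so a map into a jet space may involve infinitely many
    coordinates altogether, as prolongations do. *)
Definition smap I J (U : set (coord_space R I))
    (T : coord_space R I -> coord_space R J) :=
  forall j, fsmooth U (fun x => T x j).

Lemma smap_sub I J (U W : set (coord_space R I))
    (T : coord_space R I -> coord_space R J) : W `<=` U -> smap U T -> smap W T.
Proof. by move=> WU ST j; exact: fsmooth_sub WU (ST j). Qed.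

Lemma smap_ccvg I J (U : set (coord_space R I))
    (T : coord_space R I -> coord_space R J) x : smap U T -> U x ->
  ccvg T (cnbhs x) (T x).
Proof. by move=> ST Ux j; exact: fsmooth_cvg (ST j) Ux. Qed.

Lemma copen_preim I J (U : set (coord_space R I)) (W : set (coord_space R J))
    (T : coord_space R I -> coord_space R J) :
  copen U -> copen W -> smap U T -> copen [set x | U x /\ W (T x)].
Proof.
move=> oU oW ST x [Ux WTx]; apply: filterI; first exact: oU.
exact: (ccvg_near (smap_ccvg ST Ux) (oW _ WTx)).
Qed.

Lemma copenI I (U W : set (coord_space R I)) :
  copen U -> copen W -> copen (U `&` W).
Proof. by move=> oU oW x [Ux Wx]; apply: filterI; [exact: oU|exact: oW]. Qed.

Lemma smap_depends I J (U : set (coord_space R I))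
    (T : coord_space R I -> coord_space R J) (s : seq J) : smap U T ->
  exists S : seq I, forall x y, U x -> U y -> (forall i, i \in S -> x i = y i) ->
    forall j, j \in s -> T x j = T y j.
Proof.
move=> ST; elim: s => [|j s [S IH]]; first by exists [::].
have [_ [S' dep]] := ST j; exists (S' ++ S) => x y Ux Uy xy k.
rewrite inE => /orP[/eqP->|ks].
  by apply: dep => // i iS; apply: xy; rewrite mem_cat iS.
by apply: IH => // i iS; apply: xy; rewrite mem_cat iS orbT.
Qed.

Lemma partial_comp I J (W : set (coord_space R J))
    (T : coord_space R I -> coord_space R J) F (s : seq J) i x :
  copen W -> Ck 1 W F -> uniq s -> depends_only_on (fun j => j \in s) W F ->
  W (T x) -> (forall j, pderivable i (fun y => T y j) x) ->
  pderivable i (fun y => F (T y)) x /\ partial i (fun y => F (T y)) x =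
    \sum_(j <- s) partial j F (T x) * partial i (fun y => T y j) x.
Proof.
move=> oW CF us depF WTx dT; apply: (@is_partial _ _ (fun y => F (T y))).
have WTx' : W (T (dfwith x i (x i))) by rewrite dfwith_id.
have := chain_rule oW CF us depF WTx' (fun j => pderivableP (dT j)).
by rewrite dfwith_id.
Qed.

(** The asymmetry between [T], only of class [Ck n], and the smooth [F] serves the bootstrapping in
    [solve_coordinate], where the inverse map is not yet known to be smooth. *)
Lemma Ck_comp I J n (U : set (coord_space R I)) (W : set (coord_space R J))
    (T : coord_space R I -> coord_space R J) F :
  copen U -> copen W -> (forall x, U x -> W (T x)) ->
  (forall j, Ck n U (fun x => T x j)) -> fsmooth W F -> Ck n U (fun x => F (T x)).
Proof.
move=> oU oW UW; elim: n F => [|n IH] F CT SF.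
  split=> // x Ux; apply: (ccvg_comp (x := T x)).
    by move=> j; exact: Ck_cvg (CT j) Ux.
  exact: fsmooth_cvg SF (UW x Ux).
have [s us depF] := fsmooth_uniq SF.
have P x i : U x -> _ := fun Ux => partial_comp (i := i) oW (SF.1 1) us depF
  (UW x Ux) (fun j => (CT j).2.1 x i Ux).
split; [|split].
- move=> x Ux; apply: (ccvg_comp (x := T x)).
    by move=> j; exact: Ck_cvg (CT j) Ux.
  exact: fsmooth_cvg SF (UW x Ux).
- by move=> x i Ux; have [] := P x i Ux.
- move=> i; have C : Ck n U (fun x =>
      \sum_(j <- s) partial j F (T x) * partial i (fun y => T y j) x).
    apply: Ck_sum => // j _; apply: CkM => //; last by have [_ [_ h]] := CT j; exact: h.
    by apply: IH => [k|]; [exact/CkS/CT|exact: fsmooth_partial].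
  by apply: Ck_congr oU _ C => x Ux; have [_ ->] := P x i Ux.
Qed.

Lemma fsmooth_comp I J (U : set (coord_space R I)) (W : set (coord_space R J))
    (T : coord_space R I -> coord_space R J) F :
  copen U -> copen W -> (forall x, U x -> W (T x)) ->
  smap U T -> fsmooth W F -> fsmooth U (fun x => F (T x)).
Proof.
move=> oU oW UW ST SF; split=> [n|].
  by apply: Ck_comp UW _ SF => // j; have [] := ST j.
have [_ [s depF]] := SF; have [S depT] := smap_depends s ST.
exists S => x y Ux Uy xy; apply: depF; [exact: UW..|].
exact: depT.
Qed.

Lemma smap_comp I J K (U : set (coord_space R I)) (W : set (coord_space R J))
    (T : coord_space R I -> coord_space R J) (S : coord_space R J -> coord_space R K) :
  copen U -> copen W -> (forall x, U x -> W (T x)) ->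
  smap U T -> smap W S -> smap U (fun x => S (T x)).
Proof. by move=> oU oW UW ST SS k; exact: (fsmooth_comp oU oW UW ST (SS k)). Qed.

Lemma dirderiv_comp I J (U : set (coord_space R I)) (W : set (coord_space R J))
    (T : coord_space R I -> coord_space R J) F (d : coord_space R I)
    (d' : coord_space R J) x :
  copen U -> copen W -> smap U T -> fsmooth W F -> U x -> W (T x) ->
  (forall j, dirderiv (fun y => T y j) d x = d' j) ->
  dirderiv (fun y => F (T y)) d x = dirderiv F d' (T x).
Proof.
move=> oU oW ST SF Ux WTx dT; have [s us depF] := fsmooth_uniq SF.
rewrite (dirderivE d' oW (SF.1 1) us depF WTx).
have WTx' : W (T (fun i => x i + 0 * d i)) by rewrite line0.
have dg j : is_derive (0 : R) 1 (fun t => T (fun i => x i + t * d i) j) (d' j).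
  have [s' us' depT] := fsmooth_uniq (ST j).
  have Ux' : U (fun i => x i + 0 * d i) by rewrite line0.
  have := chain_rule oU ((ST j).1 1) us' depT Ux' (fun i => is_derive_line x d i).
  by rewrite line0 -(dirderivE d oU ((ST j).1 1) us' depT Ux) dT.
rewrite /dirderiv derive1E.
have [_] := chain_rule oW (SF.1 1) us depF WTx' dg.
by rewrite line0 => ->.
Qed.

End SmoothMaps.

(** * Inverse functions *)

Section Diffeo.
Variables (R : realType).
Implicit Types (I J K : eqType).

Definition diffeo I J (U : set (coord_space R I)) (V : set (coord_space R J))
    (T : coord_space R I -> coord_space R J) (S : coord_space R J -> coord_space R I) :=
  [/\ copen U, copen V, smap U T & smap V S] /\
  [/\ forall x, U x -> V (T x), forall y, V y -> U (S y),
      forall x, U x -> S (T x) = x & forall y, V y -> T (S y) = y].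

Definition local_diffeo I J (T : coord_space R I -> coord_space R J) x :=
  exists U V S, U x /\ diffeo U V T S.

(** [U] and [V] are cut down to the points that [T] sends into [V] and [S] sends into [U]. Callers
    thus verify the inverse identities only where both make sense. *)
Lemma local_diffeoI I J (U : set (coord_space R I)) (V : set (coord_space R J))
    (T : coord_space R I -> coord_space R J) (S : coord_space R J -> coord_space R I) x :
  copen U -> copen V -> smap U T -> smap V S -> U x -> V (T x) ->
  (forall x, U x -> V (T x) -> S (T x) = x) ->
  (forall y, V y -> U (S y) -> T (S y) = y) -> local_diffeo T x.
Proof.
move=> oU oV sT sS Ux VTx ST TS.
exists [set x | U x /\ V (T x)], [set y | V y /\ U (S y)], S; split => //.
split; split.
- exact: copen_preim.
- exact: copen_preim.
- by apply: smap_sub sT => ? [].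
- by apply: smap_sub sS => ? [].
- by move=> z [Uz Vz] /=; rewrite ST.
- by move=> z [Uz Vz] /=; rewrite TS.
- by move=> z [Uz Vz]; rewrite ST.
- by move=> z [Uz Vz]; rewrite TS.
Qed.

Lemma local_diffeo_comp I J K (T : coord_space R I -> coord_space R J)
    (T' : coord_space R J -> coord_space R K) x :
  local_diffeo T x -> local_diffeo T' (T x) -> local_diffeo (fun z => T' (T z)) x.
Proof.
move=> [U [V [S [Ux [[oU oV sT sS] [UV VU ST TS]]]]]].
move=> [U' [V' [S' [Ux' [[oU' oV' sT' sS'] [UV' VU' ST' TS']]]]]].
apply: (@local_diffeoI _ _ [set x | U x /\ U' (T x)] [set y | V' y /\ V (S' y)]
  _ (fun y => S (S' y))).
- exact: copen_preim.
- exact: copen_preim.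
- apply: (smap_comp _ oU' _ _ sT'); [exact: copen_preim|by move=> z []|].
  by apply: smap_sub sT => ? [].
- apply: (smap_comp _ oV _ _ sS); [exact: copen_preim|by move=> z []|].
  by apply: smap_sub sS' => ? [].
- by [].
- by split; [exact: UV'|rewrite ST'//; exact: UV].
- by move=> z [Uz Uz'] _; rewrite ST' ?ST.
- by move=> z [Vz Vz'] _; rewrite TS ?TS'.
Qed.

Lemma local_diffeo_congr I J (T T' : coord_space R I -> coord_space R J) W x :
  copen W -> W x -> (forall z, W z -> T z = T' z) ->
  local_diffeo T x -> local_diffeo T' x.
Proof.
move=> oW Wx TT' [U [V [S [Ux [[oU oV sT sS] [UV VU ST TS]]]]]].
apply: (@local_diffeoI _ _ (U `&` W) V _ S) => //.
- exact: copenI.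
- move=> j; apply: (@fsmooth_congr _ _ _ (fun z => T z j)); first exact: copenI.
    by move=> z [_ Wz]; rewrite TT'.
  by apply: fsmooth_sub (sT j) => z [].
- by rewrite -TT'//; exact: UV.
- by move=> z [Uz Wz] _; rewrite -TT'// ST.
- by move=> z Vz [_ Wz]; rewrite -TT'// TS.
Qed.

End Diffeo.

(** * Solving one equation for one coordinate *)

Section OneCoordinate.
Variables (R : realType) (I : eqType).
Local Notation E := (coord_space R I).
Implicit Types (x y : E) (i : I) (F : E -> R).

Lemma ccvg_cnbhs (T : E -> E) x y (A : set E) : ccvg T (cnbhs x) y -> cnbhs y A ->
  cnbhs x [set z | A (T z)].
Proof. exact: ccvg_near. Qed.

Lemma cnbhsI x (A B : set E) : cnbhs x A -> cnbhs x B -> cnbhs x (A `&` B).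
Proof. exact: filterI. Qed.

Lemma ccvg_upd (T : Type) (G : set_system T) {FG : Filter G} (y : T -> E)
    (b : T -> R) x i (a : R) : ccvg y G x -> b @ G --> a ->
  ccvg (fun t => dfwith (y t) i (b t)) G (dfwith x i a).
Proof.
move=> yx ba; apply: ccvg_dfwith; last by rewrite dfwithin.
by move=> j ij; rewrite dfwithout//; exact: yx.
Qed.

Definition box x (s : seq I) (e : R) : set E :=
  [set y | forall i, i \in s -> `|y i - x i| < e].

Lemma box_open x s e : copen (box x s e).
Proof.
move=> y; elim: s => [|i s IH] ys; first exact: filterE.
have {}IH : cnbhs y (box x s e) by apply: IH => j js; apply: ys; rewrite inE js orbT.
have ei : 0 < e - `|y i - x i| by rewrite subr_gt0; apply: ys; rewrite inE eqxx.
have /cvgrPdist_lt /(_ _ ei) yi := @cvg_coord R I i y.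
apply: filterS2 yi IH => z zi zs j; rewrite inE => /orP[/eqP->|]; last exact: zs.
rewrite ltrBrDr in zi; apply: le_lt_trans zi.
by rewrite (distrC (y i)) -[X in `|X|](subrKA (y i)) ler_normD.
Qed.

Lemma cnbhs_self x (A : set E) : cnbhs x A -> A x.
Proof. by move=> [s [e [e0 sA]]]; apply: sA => i _; rewrite subrr normr0. Qed.

Lemma cnbhs_interior x (A : set E) : cnbhs x A -> cnbhs x [set y | cnbhs y A].
Proof.
move=> [s [e [e0 sA]]].
have : cnbhs x (box x s e) by exists s, e.
apply: filterS => y ys.
by apply: filterS (box_open ys) => z; exact: sA.
Qed.

Variables (U : set E) (F : E -> R) (c : I) (x0 : E).
Hypotheses (oU : copen U) (sF : fsmooth U F) (Ux0 : U x0) (F1 : partial c F x0 = 1).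

Lemma solve_box : exists (s : seq I) (e : R),
  [/\ 0 < e, c \in s & forall x, box x0 s e x -> U x /\ 2^-1 < partial c F x].
Proof.
have sF' := fsmooth_partial c oU sF.
have : cnbhs x0 [set x | 2^-1 < partial c F x].
  have := fsmooth_cvg sF' Ux0; rewrite F1 => /cvgr_gt; apply.
  by rewrite invf_lt1//; lra.
move=> h; have [s [e [e0 H]]] := cnbhsI (oU Ux0) h.
(* [c] is listed too: the inverse reads its target value from this slot, so the list has to contain
   it to control that inverse. *)
exists (c :: s), e; split => //; first by rewrite inE eqxx.
by move=> x xs; apply: H => i si; apply: xs; rewrite inE si orbT.
Qed.

(* Near x0, [F] increases along the coordinate c, so that the intermediate value
   theorem recovers x^c from the value of [F] and the other coordinates. *)
Lemma solve_coordinate : local_diffeo (fun x => dfwith x c (F x) : E) x0.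
Proof.
have [s [d [d0 cs NU]]] := solve_box.
pose N := box x0 s d; have oN : copen N := @box_open x0 s d.
have Nx0 : N x0 by move=> i _; rewrite subrr normr0.
(* Boxes are convex along [c], which keeps the intermediate points of the mean value theorem inside
   [N]. *)
have Nin y (a b t : R) : N (dfwith y c a) -> N (dfwith y c b) ->
    Num.min a b <= t <= Num.max a b -> N (dfwith y c t).
  move=> Na Nb tab i si; have [ci|ci] := eqVneq c i; last first.
    by have := Na i si; rewrite !dfwithout.
  move: (Na i si) (Nb i si) tab; rewrite -ci !dfwithin ge_min le_max !ltr_norml.
  by lra.
have dN i x : N x -> pderivable i F x.
  by move=> /NU[Ux _]; have [/(_ 1%N) [_ [+ _]] _] := sF; exact.
(* The factor 2 inverts the lower bound [2^-1] on the derivative. This one estimate yields both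
   uniqueness of the solution and continuity of the inverse. *)
have mono y a b : N (dfwith y c a) -> N (dfwith y c b) ->
    `|b - a| <= 2 * `|F (dfwith y c b) - F (dfwith y c a)|.
  move=> Na Nb; have [t tab|t tab ->] := @partial_MVT _ _ c F y a b.
    exact: dN (Nin _ _ _ _ Na Nb tab).
  have [_ Ft] := NU _ (Nin _ _ _ _ Na Nb tab).
  rewrite normrM gtr0_norm; last by apply: lt_trans Ft.
  by have := normr_ge0 (b - a); nra.
have uniq_sol y a b : N (dfwith y c a) -> N (dfwith y c b) ->
    F (dfwith y c a) = F (dfwith y c b) -> a = b.
  move=> Na Nb Fab; have := mono _ _ _ Na Nb.
  by rewrite Fab subrr normr0 mulr0 normr_le0 subr_eq0 => /eqP.
(* The slot [c] of [y] holds the prescribed value of [F]; [psi y] is the coordinate that produces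
   it, with default [x0 c] where no solution exists. *)
pose sol y b := N (dfwith y c b) /\ F (dfwith y c b) = y c.
pose psi y := xget (x0 c) (sol y).
pose S y : E := dfwith y c (psi y).
(* Taking the interior of the solvable set makes [V] open for free; existence then has to be shown
   only around the image of [x0]. *)
pose V := [set y | cnbhs y [set z | exists b, sol z b]].
have oV : copen V by move=> y Vy; exact: cnbhs_interior.
have solP y : V y -> N (S y) /\ F (S y) = y c.
  by move=> /cnbhs_self [b /(xgetI (x0 c))].
have NT x : N x -> dfwith (dfwith x c (F x)) c (x c) = x.
  by move=> Nx; rewrite dfwith_dfwith dfwith_id.
have psiT x : N x -> V (dfwith x c (F x)) -> psi (dfwith x c (F x)) = x c.
  move=> Nx /solP[NS FS]; apply: (uniq_sol (dfwith x c (F x))) => //.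
    by rewrite NT.
  by rewrite -/(S _) FS NT// dfwithin.
have cvg_slice y a : ccvg (fun z => dfwith z c a) (cnbhs y) (dfwith y c a).
  by apply: ccvg_upd; [move=> j; exact: cvg_coord|exact: cvg_cst].
have cvgF x : N x -> F @ cnbhs x --> F x.
  by move=> /NU[Ux _]; exact: fsmooth_cvg sF Ux.
have VT : V (dfwith x0 c (F x0)).
  have Na a : `|a - x0 c| < d -> N (dfwith x0 c a).
    move=> ad i si; have [<-|ci] := eqVneq c i; first by rewrite dfwithin.
    by rewrite dfwithout// subrr normr0.
  pose y0 : E := dfwith x0 c (F x0).
  have near_end a : `|a - x0 c| < d ->
      cnbhs y0 [set y | N (dfwith y c a)] /\
      F (dfwith y c a) @[y --> cnbhs y0] --> F (dfwith x0 c a).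
    move=> ad; have Na' := Na _ ad; have := cvg_slice y0 a.
    rewrite /y0 dfwith_dfwith => h; split; first exact: ccvg_cnbhs h (oN _ Na').
    exact: ccvg_comp h (cvgF _ Na').
  (* Half the radius keeps both ends [x0 c + h] and [x0 c - h] inside the box. With slope above 1/2,
     [F] there differs from [F x0] by more than [h / 2]; both inequalities persist for nearby [y],
     and the intermediate value theorem applies between the ends. *)
  pose h := d / 2.
  have h0 : 0 < h by rewrite divr_gt0.
  have hd : h < d by rewrite /h; lra.
  have hp : `|x0 c + h - x0 c| < d by rewrite addrC addKr gtr0_norm.
  have hm : `|x0 c - h - x0 c| < d by rewrite addrC addKr normrN gtr0_norm.
  have [Np Fp] := near_end _ hp; have [Nm Fm] := near_end _ hm.
  have slope b : `|b - x0 c| < d ->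
      exists2 D, 2^-1 < D & F (dfwith x0 c b) - F x0 = D * (b - x0 c).
    move=> bd; have Nb := Na _ bd; have N0 : N (dfwith x0 c (x0 c)) by rewrite dfwith_id.
    have [t tab|t tab] := @partial_MVT _ _ c F x0 (x0 c) b.
      exact: dN (Nin _ _ _ _ N0 Nb tab).
    rewrite dfwith_id => ->; exists (partial c F (dfwith x0 c t)) => //.
    by have [_ Ft] := NU _ (Nin _ _ _ _ N0 Nb tab).
  have Fp0 : F x0 + h / 2 < F (dfwith x0 c (x0 c + h)).
    by have [D D2] := slope _ hp; rewrite addrAC subrr add0r; nra.
  have Fm0 : F (dfwith x0 c (x0 c - h)) < F x0 - h / 2.
    by have [D D2] := slope _ hm; rewrite addrAC subrr add0r; nra.
  have yc : (fun y : E => y c) @ cnbhs y0 --> F x0.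
    by have := @cvg_coord R I c y0; rewrite /y0 dfwithin.
  suff : cnbhs y0 [set z | exists b, sol z b] by [].
  have e1 : cnbhs y0 [set y | F x0 + h / 2 < F (dfwith y c (x0 c + h))].
    exact: cvgr_gt Fp _ Fp0.
  have e2 : cnbhs y0 [set y | F (dfwith y c (x0 c - h)) < F x0 - h / 2].
    exact: cvgr_lt Fm _ Fm0.
  have e3 : cnbhs y0 [set y : E | y c < F x0 + h / 2].
    by apply: cvgr_lt yc _ _; lra.
  have e4 : cnbhs y0 [set y : E | F x0 - h / 2 < y c].
    by apply: cvgr_gt yc _ _; lra.
  have H := cnbhsI (cnbhsI (cnbhsI e1 e2) (cnbhsI e3 e4)) (cnbhsI Np Nm).
  apply: filterS H => y [[[y1 y2] [y3 y4]] [y5 y6]] /=.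
  have Nt t : x0 c - h <= t <= x0 c + h -> N (dfwith y c t).
    by move=> tab; apply: (Nin _ _ _ _ y6 y5); rewrite ge_min le_max; lra.
  have le_ends : x0 c - h <= x0 c + h by lra.
  have [||b bin Fb] := IVT le_ends (v := y c) (f := fun t => F (dfwith y c t)).
  - by apply: slice_continuous => t tab; exact/dN/Nt.
  - by rewrite ge_min le_max /= in y1 y2 y3 y4 *; lra.
  - by exists b; split => //; apply: Nt; rewrite in_itv/= in bin.
have psi_cvg y : V y -> psi z @[z --> cnbhs y] --> psi y.
  move=> Vy; have [NS FS] := solP y Vy; apply/cvgrPdist_lt => e e0.
  (* The solution [psi y] serves as trial value at a nearby [z]; [mono] bounds the distance to
     [psi z] by twice the residual. *)
  have h := cvg_slice y (psi y).
  have n1 : cnbhs y [set z | N (dfwith z c (psi y))] by exact: ccvg_cnbhs h (oN _ NS).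
  have e2 : 0 < e / 2 by rewrite divr_gt0.
  have n2 : cnbhs y [set z | `|z c - F (dfwith z c (psi y))| < e / 2].
    have : z c - F (dfwith z c (psi y)) @[z --> cnbhs y] --> y c - F (S y).
      apply: cvgB; first exact: cvg_coord.
      exact: ccvg_comp h (cvgF _ NS).
    rewrite FS subrr => /cvgrPdist_lt /(_ _ e2) H.
    by apply: filterS H => z /=; rewrite sub0r normrN.
  have H := cnbhsI (oV y Vy) (cnbhsI n1 n2); apply: filterS H => z [Vz [z1 z2]].
  have [NSz FSz] := solP z Vz.
  rewrite distrC; apply: le_lt_trans (mono _ _ _ z1 NSz) _.
  by rewrite -/(S z) FSz; rewrite /= in z2; lra.
have Scvg y : V y -> ccvg S (cnbhs y) (S y).
  by move=> Vy; apply: ccvg_upd; [move=> j; exact: cvg_coord|exact: psi_cvg].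
(* The implicit differentiation formula: [psi] has derivative 1 / F_c along [c] and - F_i / F_c
   along any other [i], evaluated at [S y]. *)
pose kap i x := (if c == i then 1 else - partial i F x) * (partial c F x)^-1.
have psi_der y i : V y -> is_derive (y i) 1 (fun t => psi (dfwith y i t)) (kap i (S y)).
  move=> Vy; have [NS FS] := solP y Vy.
  have [US F2] := NU _ NS.
  pose w t : E := dfwith y i t; pose b t := psi (w t).
  have wy : ccvg w (nbhs (y i)) y.
    by apply: ccvg_dfwith; [move=> j _; exact: cvg_cst|exact: cvg_id].
  have wS : ccvg (fun t => dfwith (w t) c (psi y)) (nbhs (y i)) (S y).
    by apply: ccvg_upd => //; exact: cvg_cst.
  have by_ : b @ nbhs (y i) --> S y c.
    by rewrite /S dfwithin; exact: ccvg_comp wy (psi_cvg y Vy).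
  have dS j : cnbhs (S y) (pderivable j F).
    by apply: filterS (oN _ NS) => z; exact: dN.
  have cS j := fsmooth_cvg (fsmooth_partial j oU sF) US.
  have [Q Qc Qn] := slope_cvg (dS c) (cS c) wS by_.
  have {}Qn : \forall t \near y i,
      F (dfwith (w t) c (b t)) - F (dfwith (w t) c (psi y)) = Q t * (b t - psi y).
    by apply: filterS Qn => t; rewrite dfwith_dfwith dfwithin.
  have Vw : \forall t \near y i, V (w t) by exact: ccvg_near wy (oV y Vy).
  have Q0 : \forall t \near y i, Q t != 0.
    by apply: cvgr_neq0 Qc _; rewrite gt_eqF//; lra.
  (* The residual left by the trial value [psi y] is [Q t] times the change of [psi], because
     [F (S (w t)) = w t c], and also [K t] times the change of the coordinate [i]. The quotient of
     [K] and [Q] is the slope of [psi]. *)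
  have [K Kc Kn] : exists2 K : R -> R,
      K @ nbhs (y i) --> (if c == i then 1 else - partial i F (S y)) &
      \forall t \near y i, w t c - F (dfwith (w t) c (psi y)) = K t * (t - y i).
    case: eqVneq => [ci|ci].
      exists (cst 1); first exact: cvg_cst.
      near=> t; rewrite mul1r /w -ci dfwithin dfwith_dfwith.
      by rewrite -/(S y) FS.
    have Sc : ccvg (cst (S y)) (nbhs (y i)) (S y) by move=> j; exact: cvg_cst.
    have Si : S y i = y i by rewrite /S dfwithout.
    have idc : id @ nbhs (y i) --> S y i by rewrite Si.
    have [L Lc Ln] := slope_cvg (dS i) (cS i) Sc idc.
    exists (fun t => - L t); first exact: cvgN.
    apply: filterS Ln => t; rewrite /cst Si FS => Lt.
    rewrite mulNr -Lt opprB /w dfwithout 1?eq_sym//; congr (_ - F _).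
    apply/funext => j; rewrite /S; have [<-|cj] := eqVneq c j.
      by rewrite dfwithin dfwithout 1?eq_sym// dfwithin.
    rewrite dfwithout//; have [<-|ij] := eqVneq i j; first by rewrite !dfwithin.
    by rewrite !dfwithout.
  have KQ : K t * (Q t)^-1 @[t --> y i] --> kap i (S y).
    by apply: cvgM => //; apply: cvgV => //; rewrite gt_eqF//; lra.
  rewrite -[X in is_derive _ _ _ X]mulr1.
  apply: (is_derive_slope (is_derive_id _ _) KQ).
  near=> t.
  have Qt : Q t != 0 by near: t.
  have [NSt FSt] : N (S (w t)) /\ F (S (w t)) = w t c by apply: solP; near: t.
  have Qe : F (dfwith (w t) c (b t)) - F (dfwith (w t) c (psi y)) =
      Q t * (b t - psi y) by near: t.
  have Ke : w t c - F (dfwith (w t) c (psi y)) = K t * (t - y i) by near: t.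
  rewrite -/(S (w t)) FSt Ke in Qe.
  by rewrite dfwith_id mulrAC Qe mulrAC mulfV// mul1r.
have sS : smap V S.
  have sK i : fsmooth N (kap i).
    have sFN : fsmooth N F by apply: fsmooth_sub sF => x /NU[].
    apply: fsmoothM => //.
      case: (c == i); first exact: fsmooth_cst.
      exact: fsmoothN (fsmooth_partial _ _ _).
    have [C [t dep]] := fsmooth_partial c oN sFN.
    split=> [n|]; last by exists t => x y Nx Ny xy; rewrite (dep x y).
    apply: CkV => // x /NU[_ h]; rewrite gt_eqF//; lra.
  (* Bootstrapping: the partial derivatives of [psi] are [kap i] composed with [S], hence as regular
     as [psi] itself. *)
  have Cpsi n : Ck n V psi.
    elim: n => [|n IH]; first by split => // y; exact: psi_cvg.
    split; first by move=> y; exact: psi_cvg.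
    have P y i : V y -> _ := fun Vy => is_partial (F := psi) (psi_der y i Vy).
    split=> [y i Vy|i]; first by have [] := P y i Vy.
    have : Ck n V (fun y => kap i (S y)).
      apply: (Ck_comp oV oN _ _ (sK i)) => [y /solP[]//|j].
      have [<-|cj] := eqVneq c j.
        by apply: (Ck_congr oV _ IH) => y _; rewrite /S dfwithin.
      by apply: (Ck_congr oV _ (Ck_coord n V j)) => y _; rewrite /S dfwithout.
    by apply: Ck_congr oV _ => y Vy; have [_ ->] := P y i Vy.
  have [_ [t depF]] := sF.
  (* If [y] and [z] agree on the list, [psi y] also solves the equation at [z]; uniqueness gives
     [psi y = psi z]. *)
  have dpsi : depends_only_on (fun i => i \in s ++ t) V psi.
    move=> y z Vy Vz yz; have [NSy FSy] := solP y Vy; have [NSz FSz] := solP z Vz.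
    have Nzy : N (dfwith z c (psi y)).
      move=> i si; have [ci|ci] := eqVneq c i.
        by rewrite -ci dfwithin; have := NSy c cs; rewrite /S dfwithin.
      rewrite dfwithout// -yz ?mem_cat ?si//.
      by have := NSy i si; rewrite /S dfwithout.
    apply: (uniq_sol z) => //; rewrite -/(S z) FSz -yz ?mem_cat ?cs// -FSy.
    apply: depF; [by have [] := NU _ Nzy|by have [] := NU _ NSy|].
    move=> i it; rewrite /S; have [<-|ci] := eqVneq c i; first by rewrite !dfwithin.
    by rewrite !dfwithout// yz// mem_cat it orbT.
  have spsi : fsmooth V psi by split => //; exists (s ++ t).
  move=> j; have [<-|cj] := eqVneq c j.
    by apply: (fsmooth_congr oV _ spsi) => y _; rewrite /S dfwithin.
  by apply: (fsmooth_congr oV _ (fsmooth_coord V j)) => y _; rewrite /S dfwithout.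
apply: (local_diffeoI oN oV _ sS Nx0 VT).
- move=> j; have [<-|cj] := eqVneq c j.
    have sFN : fsmooth N F by apply: fsmooth_sub sF => x /NU[].
    by apply: (fsmooth_congr oN _ sFN) => y _; rewrite dfwithin.
  by apply: (fsmooth_congr oN _ (fsmooth_coord N j)) => y _; rewrite dfwithout.
- by move=> x Nx VTx; rewrite /S psiT// NT.
- by move=> y Vy _; have [_ FS] := solP y Vy; rewrite FS /S dfwith_dfwith dfwith_id.
Unshelve. all: by end_near. Qed.

End OneCoordinate.

(** * Inverse function theorem and local surjectivity *)

Section InverseFunction.
Variables (R : realType) (I : eqType).
Local Notation E := (coord_space R I).
Implicit Types (x y : E) (i j : I) (F : E -> R) (T S : E -> E) (U : set E).

Lemma fsmooth_pderivable U F i x : fsmooth U F -> U x -> pderivable i F x.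
Proof. by move=> [/(_ 1%N) [_ [dF _]] _] Ux; exact: dF. Qed.

Lemma copenT : copen (setT : set E).
Proof. by move=> x _; exact: filterT. Qed.

Lemma partial_comp_solve U V F S c i y : copen U -> copen V -> fsmooth U F ->
  smap V S -> V y -> U (S y) -> i != c ->
  (forall z k, V z -> k != c -> S z k = z k) ->
  partial i (fun z => F (S z)) y =
    partial i F (S y) + partial c F (S y) * partial i (fun z => S z c) y.
Proof.
move=> oU oV sF sS Vy USy ic Sout.
(* The list is padded with [i] and [c] so that their two terms can be split off; all others vanish,
   as [S] alters the coordinate [c] only. *)
have [_ [s0 dep0]] := sF; pose s := undup (i :: c :: s0).
have dep : depends_only_on (fun j => j \in s) U F.
  by apply: depends_sub dep0 => // j js; rewrite mem_undup !inE js !orbT.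
have us : uniq s by exact: undup_uniq.
have dS k := fsmooth_pderivable (i := i) (sS k) Vy.
have [_ ->] := partial_comp oU (sF.1 1%N) us dep USy dS.
have Sk k : k != c -> partial i (fun z => S z k) y = (i == k)%:R.
  move=> kc; have -> : partial i (fun z => S z k) y = partial i (fun z => z k) y.
    by apply: (partial_congr i oV _ Vy) => z Vz; exact: Sout.
  by rewrite partial_coord.
rewrite (bigD1_seq i)/= ?mem_undup ?inE ?eqxx// Sk// eqxx mulr1; congr (_ + _).
rewrite -big_filter (bigD1_seq c)/=; last exact: filter_uniq.
  rewrite big1_seq ?addr0// => k /andP[kc]; rewrite mem_filter => /andP[ki _].
  by rewrite Sk// eq_sym (negbTE ki) mulr0.
by rewrite mem_filter eq_sym ic mem_undup !inE eqxx orbT.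
Qed.

Lemma local_diffeo_id x : local_diffeo (fun z : E => z) x.
Proof.
exists setT, setT, (fun z => z); split => //.
by do 2!split => //; [exact: copenT|exact: copenT|move=> j; exact: fsmooth_coord..].
Qed.

(* The coordinates are exchanged one at a time: when the Jacobian is the identity,
   solving for one coordinate leaves an identity Jacobian in the others. *)
Lemma inverse_function_id (cs : seq I) T U x : uniq cs -> copen U -> smap U T -> U x ->
  (forall z j, U z -> j \notin cs -> T z j = z j) ->
  (forall i j, i \in cs -> j \in cs -> partial i (fun z => T z j) x = (i == j)%:R) ->
  local_diffeo T x.
Proof.
elim: cs T U x => [|c cs IH] T U x ucs oU sT Ux Tout Tid.
  apply: (local_diffeo_congr oU Ux _ (local_diffeo_id x)) => z Uz.
  by apply/funext => j; rewrite Tout.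
move: ucs => /= /andP[ccs ucs].
pose T1 z : E := dfwith z c (T z c).
have T1d : local_diffeo T1 x.
  by apply: (solve_coordinate oU (sT c) Ux); rewrite Tid ?inE ?eqxx.
have [U1 [V1 [S [U1x [[oU1 oV1 sT1 sS] [UV VU ST TS]]]]]] := T1d.
have Sout z k : V1 z -> k != c -> S z k = z k.
  by move=> /TS {2}<- kc; rewrite /T1 dfwithout// eq_sym.
have TSc z : V1 z -> T (S z) c = z c.
  by move=> /TS {2}<-; rewrite /T1 dfwithin.
(* The remaining components of [T], expressed in coordinates in which [c] has been replaced by
   [T z c]. *)
pose T2 y : E := fun j => if j \in cs then T (S y) j else y j.
pose W := [set y | V1 y /\ U (S y)].
have oW : copen W by exact: copen_preim.
have sSW : smap W S by apply: smap_sub sS => z [].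
have T2d : local_diffeo T2 (T1 x).
  apply: (IH T2 W) => //.
  - move=> j; rewrite /T2; case: (j \in cs); last exact: fsmooth_coord.
    by apply: (fsmooth_comp oW oU _ sSW (sT j)) => z [].
  - by split; [exact: UV|rewrite ST].
  - by move=> z j _ /negbTE jcs; rewrite /T2 jcs.
  move=> i j ics jcs; rewrite /T2 jcs.
  have ic : i != c by apply: contraNneq ccs => <-.
  have Vy := UV _ U1x; have USy : U (S (T1 x)) by rewrite ST.
  have E1 F : fsmooth U F -> _ :=
    fun sF => partial_comp_solve oU oV1 sF sS Vy USy ic Sout.
  (* Differentiating [T (S z) c = z c] along [i], with diagonal entry 1 and off-diagonal entry 0,
     shows that the solved coordinate is stationary along [i]. The correction term in [E1] therefore
     drops out. *)
  have icS : partial i (fun z => S z c) (T1 x) = 0.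
    have := E1 _ (sT c); rewrite ST// !Tid ?inE ?eqxx ?ics ?orbT//.
    rewrite (negbTE ic) add0r mul1r => <-.
    have -> : partial i (fun z => T (S z) c) (T1 x) = partial i (fun z => z c) (T1 x).
      by apply: (partial_congr i oV1 _ Vy) => z; exact: TSc.
    by rewrite partial_coord /= (negbTE ic).
  by rewrite (E1 _ (sT j)) icS mulr0 addr0 ST// Tid// inE ?ics ?jcs orbT.
apply: (local_diffeo_congr (copenI oU oU1) _ _ (local_diffeo_comp T1d T2d)) => //.
move=> z [Uz U1z]; apply/funext => j; rewrite /T2 ST//.
case: ifPn => // jcs; rewrite /T1; have [<-|cj] := eqVneq c j.
  by rewrite dfwithin.
by rewrite dfwithout// Tout// inE negb_or eq_sym cj.
Qed.

Section Override.
Variables (n : nat) (c : 'I_n -> I).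
Hypothesis (c_inj : injective c).

Definition override (v : 'I_n -> R) x : E :=
  fun j => if [pick k | c k == j] is Some k then v k else x j.

Lemma override_in v x k : override v x (c k) = v k.
Proof.
rewrite /override; case: pickP => [l /eqP/c_inj -> //|/(_ k)].
by rewrite eqxx.
Qed.

Lemma override_out v x j : j \notin codom c -> override v x j = x j.
Proof.
rewrite /override; case: pickP => // l /eqP <-.
by rewrite codom_f.
Qed.

Variant override_spec v x : I -> R -> Type :=
  | OverrideIn k : override_spec v x (c k) (v k)
  | OverrideOut j : j \notin codom c -> override_spec v x j (x j).

Lemma overrideP v x j : override_spec v x j (override v x j).
Proof.
have [|jc] := boolP (j \in codom c); last by rewrite override_out//; constructor.
move=> /codomP/cid[k ->]; rewrite override_in; constructor.
Qed.

Lemma fsmooth_override U (g : 'I_n -> E -> R) : (forall k, fsmooth U (g k)) ->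
  smap U (fun x => override (fun k => g k x) x).
Proof.
move=> sg j; rewrite /override; case: pickP => [k _|_] //.
exact: fsmooth_coord.
Qed.

Definition linear_override (A : 'M[R]_n) x : E :=
  override (fun k => \sum_l A k l * x (c l)) x.

Lemma linear_override_comp A B x :
  linear_override A (linear_override B x) = linear_override (A *m B) x.
Proof.
apply/funext => j; rewrite {1}/linear_override.
case: overrideP => [k|{}j jc]; last by rewrite /linear_override !override_out.
rewrite /linear_override override_in.
under eq_bigr do rewrite override_in mulr_sumr.
rewrite exchange_big/=; apply: eq_bigr => l _; rewrite mxE mulr_suml.
by apply: eq_bigr => k' _; rewrite mulrA.
Qed.

Lemma linear_override1 x : linear_override 1%:M x = x.
Proof.
apply/funext => j; rewrite /linear_override; case: overrideP => // k.
rewrite (bigD1 k)//= mxE eqxx mul1r big1 ?addr0// => l lk.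
by rewrite mxE eq_sym (negbTE lk) mul0r.
Qed.

Lemma fsmooth_linear (J : Type) (r : seq J) (a : J -> R) U (F : J -> E -> R) :
  copen U -> (forall k, fsmooth U (F k)) ->
  fsmooth U (fun x => \sum_(k <- r) a k * F k x).
Proof.
move=> oU sF; apply: fsmooth_sum => // k _; apply: fsmoothM => //.
exact: fsmooth_cst.
Qed.

Lemma local_diffeo_linear A x : A \in unitmx -> local_diffeo (linear_override A) x.
Proof.
move=> uA; have oT := copenT.
have sm B : smap setT (linear_override B).
  apply: fsmooth_override => k; apply: fsmooth_linear => // l.
  exact: fsmooth_coord.
exists setT, setT, (linear_override (invmx A)); split => //; split => //.
by split => // y _; rewrite linear_override_comp ?mulVmx ?mulmxV// linear_override1.
Qed.

Lemma partial_linear (r : seq 'I_n) (a : 'I_n -> R) U (F : 'I_n -> E -> R) i x :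
  copen U -> (forall k, fsmooth U (F k)) -> U x ->
  partial i (fun x => \sum_(k <- r) a k * F k x) x = \sum_(k <- r) a k * partial i (F k) x.
Proof.
move=> oU sF Ux; elim: r => [|k r IH].
  transitivity (partial i (cst 0 : E -> R) x).
    by apply: (partial_congr i oU _ Ux) => y _; rewrite big_nil.
  by rewrite big_nil; exact: (is_partial_cst 0 x i).2.
have dk : pderivable i (fun y => a k * F k y) x.
  have sk : fsmooth U (fun y => a k * F k y).
    by apply: fsmoothM => //; exact: fsmooth_cst.
  exact: fsmooth_pderivable sk Ux.
have dr := fsmooth_pderivable (i := i) (fsmooth_linear r a oU sF) Ux.
rewrite big_cons -IH.
have dc := (is_partial_cst (a k) x i).
have [_ <-] : pderivable i (fun y => a k * F k y) x /\
    partial i (fun y => a k * F k y) x = a k * partial i (F k) x.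
  have [d ->] := is_partialM dc.1 (fsmooth_pderivable (i := i) (sF k) Ux).
  by split => //; rewrite dc.2 mul0r addr0.
rewrite -(is_partialD dk dr).2; apply: (partial_congr i oU _ Ux) => y _.
by rewrite big_cons.
Qed.

(** Premultiplying [g] by the inverse of its Jacobian at [x] reduces to an identity Jacobian, and
    [linear_override] undoes the normalization. As coordinates outside the image of [c] are kept,
    the implicit function theorem with parameters is included. *)
Theorem inverse_function (g : 'I_n -> E -> R) U x :
  copen U -> (forall k, fsmooth U (g k)) -> U x ->
  \matrix_(k, l) partial (c l) (g k) x \in unitmx ->
  local_diffeo (fun z => override (fun k => g k z) z) x.
Proof.
move=> oU sg Ux; set A := \matrix_(k, l) _ => uA.
pose h k z := \sum_l invmx A k l * g l z.
have sh k : fsmooth U (h k) by exact: fsmooth_linear.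
have hd : local_diffeo (fun z => override (fun k => h k z) z) x.
  apply: (@inverse_function_id (codom c) _ U) => //.
  - exact/injectiveP.
  - exact: fsmooth_override.
  - by move=> z j _ jc; rewrite override_out.
  move=> i j /codomP[l ->] /codomP[k ->].
  under eq_fun do rewrite override_in.
  rewrite (partial_linear _ _ _ oU sg Ux) (inj_eq c_inj).
  transitivity ((invmx A *m A) k l); last by rewrite mulVmx// mxE eq_sym.
  by rewrite mxE; apply: eq_bigr => q _; rewrite [A q l]mxE.
apply: (local_diffeo_congr copenT _ _ (local_diffeo_comp hd
  (local_diffeo_linear _ uA))) => // z _.
apply/funext => j; rewrite /linear_override.
case: overrideP => [k|{}j jc]; last by rewrite !override_out.
rewrite override_in; under eq_bigr do rewrite override_in /h mulr_sumr.
rewrite exchange_big/= [LHS](_ : _ = \sum_q (A *m invmx A) k q * g q z); last first.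
  apply: eq_bigr => q _; rewrite [in RHS]mxE mulr_suml.
  by apply: eq_bigr => q' _; rewrite mulrA.
rewrite mulmxV// (bigD1 k)//= mxE eqxx mul1r big1 ?addr0// => q qk.
by rewrite mxE eq_sym (negbTE qk) mul0r.
Qed.

End Override.

(** Independence gives [M] full rank, so [fullrankfun] selects as many coordinates as there are
    functions, with invertible Jacobian. The inverse function theorem in these coordinates then
    provides a preimage, the others staying as in [x]; [W] keeps it in a prescribed
    neighbourhood. *)
Theorem local_surjection (K : finType) (g : K -> E -> R) U W x :
  copen U -> (forall k, fsmooth U (g k)) -> U x -> copen W -> W x ->
  (forall a : K -> R, (forall i, \sum_k a k * partial i (g k) x = 0) ->
    forall k, a k = 0) ->
  exists e : R, 0 < e /\ forall y : K -> R, (forall k, `|y k - g k x| < e) ->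
    exists z, W z /\ forall k, g k z = y k.
Proof.
move=> oU sg Ux oW Wx ind.
have [s0 dep0] := @smap_depends R I K U (fun z k => g k z) (enum K) sg.
pose s := in_tuple (undup s0).
pose M := \matrix_(a < size (undup s0), k < #|K|)
  partial (tnth s a) (g (enum_val k)) x.
have Mfull : row_full M.
  rewrite /row_full -mxrank_tr; apply: (@inj_row_free _ _ _ M^T) => v vM.
  apply/rowP => k; rewrite mxE.
  have := ind (fun k => v 0 (enum_rank k)) _ (enum_val k); rewrite enum_valK; apply.
  move=> i; have [/tnthP[a ->]|is'] := boolP (i \in s).
    transitivity ((v *m M^T) 0 a); last by rewrite vM mxE.
    rewrite mxE (reindex_onto enum_val enum_rank) => [|k' _]; last by rewrite enum_rankK.
    apply: eq_big => [k'|k' _]; first by rewrite enum_valK eqxx.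
    by rewrite enum_valK !mxE.
  rewrite big1// => k' _.
  rewrite (@partial_out _ _ (fun i => i \in undup s0) U) ?mulr0//.
  move=> y z Uy Uz yz; apply: (dep0 y z) => //; last by rewrite mem_enum.
  by move=> j js; apply: yz; rewrite mem_undup.
pose c (k : 'I_#|K|) := tnth s (fullrankfun Mfull k).
have c_inj : injective c.
  by move=> k l /(tuple_uniqP s (undup_uniq s0)); exact: fullrankfun_inj.
pose h (k : 'I_#|K|) := g (enum_val k).
have hd : local_diffeo (fun z => override c (fun k => h k z) z) x.
  apply: (inverse_function c_inj oU) => //; first by move=> k; exact: sg.
  rewrite -unitmx_tr [X in X \in _](_ : _ = rowsub (fullrankfun Mfull) M).
    exact: fullrowsub_unit.
  by apply/matrixP => k l; rewrite !mxE.
have [U1 [V1 [S [U1x [[oU1 oV1 sT sS] [UV VU ST TS]]]]]] := hd.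
set T := (fun z => _) in sT UV ST TS.
have oW1 : copen [set y | V1 y /\ W (S y)] by exact: copen_preim.
have [|t [e [e0 tW]]] := oW1 (T x); first by split; [exact: UV|rewrite ST].
exists e; split => // y yx.
pose w := override c (fun k => y (enum_val k)) x.
have [|V1w WS] := tW w.
  move=> j _; rewrite /w /T; have [/codomP[k ->]|jc] := boolP (j \in codom c).
    by rewrite !override_in.
  by rewrite !override_out// subrr normr0.
exists (S w); split => // k.
have := congr1 (fun z : E => z (c (enum_rank k))) (TS _ V1w).
by rewrite /T /w !override_in// /h enum_rankK.
Qed.

End InverseFunction.

(** * Time derivatives and prolongations *)

Section Germs.
Variables (R : realType) (I : eqType).
Local Notation E := (coord_space R I).

Lemma nearP (x : E) (Q : E -> Prop) : (\forall z \near x, Q z) <-> cnbhs x Q.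
Proof. by rewrite -nbhs_coordE. Qed.

Lemma cnbhs_open (x : E) (Q : set E) : cnbhs x Q ->
  exists U : set E, [/\ copen U, U x & U `<=` Q].
Proof.
move=> xQ; exists [set y | cnbhs y Q]; split => //; last by move=> y /cnbhs_self.
by move=> y; exact: cnbhs_interior.
Qed.

Lemma smooth_at_family (K : finType) (P : pred I) (s : seq I) (x : E)
    (F : K -> E -> R) :
  (forall i, P i -> i \in s) -> (forall k, smooth_at P x (F k)) ->
  exists U : set E, [/\ copen U, U x & forall k, fsmooth U (F k)].
Proof.
move=> Ps sF.
have /choice[U UP] : forall k, exists U : set E, [/\ copen U, U x & fsmooth U (F k)].
  move=> k; have [U [oU Ux depF sU]] := sF k; exists U; split => //.
    exact/openP.
  by split; [exact/smooth_onP|exists s; exact: depends_sub depF].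
exists [set y | forall k, U k y]; split.
- move=> y Uy; apply: (@filter_forall _ _ U (cnbhs y)) => k.
  by have [oU _ _] := UP k; exact: oU.
- by move=> k; have [] := UP k.
- by move=> k; have [_ _] := UP k; apply: fsmooth_sub => y; exact.
Qed.

Lemma fsmooth_smooth_at (P : pred I) (U : set E) x F :
  copen U -> U x -> fsmooth U F -> depends_only_on P U F -> smooth_at P x F.
Proof.
move=> oU Ux [CF _] depF; exists U; split => //; first exact/openP.
exact/smooth_onP.
Qed.

Lemma dirderiv_coord (d x : E) i : dirderiv (fun y => y i) d x = d i.
Proof. by rewrite /dirderiv derive1E; have [_ ->] := is_derive_line x d i. Qed.

Lemma dirderiv0 (F : E -> R) (d x : E) : (forall i, d i = 0) -> dirderiv F d x = 0.
Proof.
move=> d0; apply: (@derive1_near_cst _ _ _ (F x)); near=> t.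
by congr F; apply/funext => i; rewrite d0 mulr0 addr0.
Unshelve. all: by end_near. Qed.

Lemma dirderiv_congr (U : set E) (F G : E -> R) (d x : E) : copen U -> U x ->
  (forall y, U y -> F y = G y) -> dirderiv F d x = dirderiv G d x.
Proof.
move=> oU Ux FG; apply: derive1_congr.
have lx : ccvg (fun t : R => (fun i => x i + t * d i) : E) (nbhs (0 : R)) x.
  by move=> i; have := is_derive_cvg (is_derive_line x d i); rewrite mul0r addr0.
have : \forall t \near (0 : R), U (fun i => x i + t * d i).
  exact: (ccvg_near (A := U) lx (oU x Ux)).
by apply: filterS => t; exact: FG.
Qed.

End Germs.

Section ControlSystem.
Variables (R : realType) (n m : nat) (f : 'I_n -> state_input R n m -> R).
Local Notation Jet := (coord_space R ('I_n + nat * 'I_m)%type).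
Local Notation Out := (coord_space R (nat * 'I_m)%type).
Variable Uf : set (coord_space R ('I_n + 'I_m)%type).
Hypotheses (oUf : copen Uf) (sf : forall i, fsmooth Uf (f i)).
Implicit Types (a b : 'I_m -> Jet -> R) (z : Jet) (D : set Jet).

Definition input_point a z : coord_space R ('I_n + 'I_m)%type :=
  pair_point (fun i => z (inl i)) (fun j => a j z).

Definition admissible a D : set Jet := [set z | D z /\ Uf (input_point a z)].

Lemma smap_input_point a D : (forall j, fsmooth D (a j)) -> smap D (input_point a).
Proof. by move=> sa [i|j] /=; [exact: fsmooth_coord|exact: sa]. Qed.

Lemma admissible_open a D : copen D -> (forall j, fsmooth D (a j)) ->
  copen (admissible a D).
Proof. by move=> oD sa; exact: copen_preim (smap_input_point sa). Qed.

Lemma smap_vector_field a D : copen D -> (forall j, fsmooth D (a j)) ->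
  (forall z, D z -> Uf (input_point a z)) -> smap D (vector_field f a).
Proof.
move=> oD sa DU [i|[k j]] /=; last exact: fsmooth_coord.
exact: (fsmooth_comp oD oUf DU (smap_input_point sa) (sf i)).
Qed.

Lemma fsmooth_time_deriv a D F : copen D -> (forall j, fsmooth D (a j)) ->
  (forall z, D z -> Uf (input_point a z)) -> fsmooth D F ->
  fsmooth D (time_deriv f a F).
Proof.
move=> oD sa DU sF; have [s us depF] := fsmooth_uniq sF.
apply: (@fsmooth_congr _ _ D
    (fun z => \sum_(c <- s) partial c F z * vector_field f a z c)) => //.
  by move=> z Dz; rewrite /time_deriv (dirderivE _ oD (sF.1 1%N) us depF Dz).
apply: fsmooth_sum => // c _; apply: fsmoothM => //; first exact: fsmooth_partial.
exact: smap_vector_field.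
Qed.

Lemma fsmooth_iter a D F k : copen D -> (forall j, fsmooth D (a j)) ->
  (forall z, D z -> Uf (input_point a z)) -> fsmooth D F ->
  fsmooth D (iter k (time_deriv f a) F).
Proof. by move=> oD sa DU sF; elim: k => [|k IH] //=; exact: fsmooth_time_deriv. Qed.

Lemma smap_prolong a b D : copen D -> (forall j, fsmooth D (a j)) ->
  (forall z, D z -> Uf (input_point a z)) -> (forall j, fsmooth D (b j)) ->
  smap D (prolong f a b).
Proof.
move=> oD sa DU sb [i|[k j]] /=; first exact: fsmooth_coord.
exact: fsmooth_iter.
Qed.

Lemma iter_congr a D F G k z : copen D -> D z -> (forall y, D y -> F y = G y) ->
  iter k (time_deriv f a) F z = iter k (time_deriv f a) G z.
Proof.
move=> oD Dz FG; elim: k z Dz => [|k IH] z Dz /=; first exact: FG.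
by apply: (dirderiv_congr _ oD Dz) => y; exact: IH.
Qed.

Lemma iter_coord a k j :
  iter k (time_deriv f a) (fun z => z (inr (0%N, j))) = fun z => z (inr (k, j)).
Proof.
elim: k => [|k IH] //=; rewrite IH; apply/funext => z.
by rewrite /time_deriv dirderiv_coord.
Qed.

(* [prolong a b] maps trajectories under the control [a] to trajectories under
   [a'], hence commutes with time differentiation. *)
Lemma iter_prolong a b a' D W F k z : copen D -> copen W ->
  smap D (prolong f a b) -> (forall y, D y -> W (prolong f a b y)) ->
  (forall j, fsmooth W (a' j)) -> (forall y, W y -> Uf (input_point a' y)) ->
  (forall y j, D y -> a j y = a' j (prolong f a b y)) -> fsmooth W F -> D z ->
  iter k (time_deriv f a) (fun y => F (prolong f a b y)) z =
  iter k (time_deriv f a') F (prolong f a b z).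
Proof.
move=> oD oW sT DW sa' WU aa' sF; elim: k z => [|k IH] z Dz //=.
have sk : fsmooth W (iter k (time_deriv f a') F) by exact: fsmooth_iter.
rewrite {1}/time_deriv (dirderiv_congr _ oD Dz IH).
apply: (dirderiv_comp oD oW sT sk Dz (DW _ Dz)) => -[i|[l j]] //=.
rewrite dirderiv_coord /=; congr (f i _).
by apply/funext => -[i'|j] //=; exact: aa'.
Qed.

Variables (xs : 'I_n -> R) (us : 'I_m -> R).
Hypotheses (equil : equilibrium f xs us) (Uxu : Uf (pair_point xs us)).

Lemma input_point_constant a (ws : 'I_m -> R) :
  (forall j, a j (constant_jet xs ws) = us j) ->
  input_point a (constant_jet xs ws) = pair_point xs us.
Proof. by move=> aus; apply/funext => -[i|j] //=; exact: aus. Qed.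

(** The whole vector field vanishes at this point: [f] by the equilibrium condition, and w_[k+1]
    because the jet is constant. *)
Lemma time_deriv_equilibrium a (ws : 'I_m -> R) F :
  (forall j, a j (constant_jet xs ws) = us j) ->
  time_deriv f a F (constant_jet xs ws) = 0.
Proof.
move=> aus; apply: dirderiv0 => -[i|[k j]] //=.
rewrite (_ : pair_point _ _ = pair_point xs us); first exact: equil.
exact: input_point_constant.
Qed.

Lemma prolong_constant a b (ws : 'I_m -> R) :
  (forall j, a j (constant_jet xs ws) = us j) ->
  prolong f a b (constant_jet xs ws) =
  constant_jet xs (fun j => b j (constant_jet xs ws)).
Proof.
move=> aus; apply/funext => -[i|[[|k] j]] //=.
exact: time_deriv_equilibrium.
Qed.

End ControlSystem.

(** * Flat outputs and quasi-static feedback *)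

Definition jet_seq (n m l : nat) : seq ('I_n + nat * 'I_m) :=
  [seq inl i | i <- enum 'I_n] ++
  [seq inr (k, j) | k <- iota 0 l.+1, j <- enum 'I_m].

Lemma jet_seqP n m l (e : 'I_n + nat * 'I_m) : up_to_order l e = (e \in jet_seq n m l).
Proof.
rewrite mem_cat; case: e => [i|[k j]]; first by rewrite map_f ?mem_enum.
have -> : (inr (k, j) \in [seq inl i | i <- enum 'I_n]) = false.
  by apply/negbTE/mapP => -[].
rewrite orFb; apply/idP/idP => [kl|/allpairsPdep[k' [j' [+ _ [-> _]]]]].
  apply/allpairsPdep; exists k, j.
  by rewrite mem_enum mem_iota ltnS.
by rewrite mem_iota ltnS.
Qed.

Lemma finite_order (n m : nat) (s : seq ('I_n + nat * 'I_m)) :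
  exists l, forall e, e \in s -> up_to_order l e.
Proof.
elim: s => [|e s [l IH]]; first by exists 0%N.
exists (maxn l (if e is inr (k, _) then k else 0%N)) => d.
rewrite inE => /orP[/eqP->|/IH].
  by case: e => [i|[k j]] //=; rewrite leq_maxr.
by case: d => [i|[k j]] //= kl; rewrite leq_max kl.
Qed.

Section Flatness.
Variables (R : realType) (n m : nat) (f : 'I_n -> state_input R n m -> R).
Local Notation Jet := (coord_space R ('I_n + nat * 'I_m)%type).
Local Notation Out := (coord_space R (nat * 'I_m)%type).
Variable Uf : set (coord_space R ('I_n + 'I_m)%type).
Hypotheses (oUf : copen Uf) (sf : forall i, fsmooth Uf (f i)).
Variables (xs : 'I_n -> R) (us : 'I_m -> R).
Hypotheses (equil : equilibrium f xs us) (Uxu : Uf (pair_point xs us)).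
Variables (phi : 'I_m -> Jet -> R) (kappa : 'I_m -> nat).
Variables (Fx : 'I_n -> Out -> R) (Fu : 'I_m -> Out -> R).

Let ol : 'I_m -> Jet -> R := @open_loop R n m.
Let Phi : Jet -> Out := output_map f phi.
Let xi0 : Jet := constant_jet xs us.

(** Domains small enough for every local hypothesis to hold at all of their points. *)
Variables (D : set Jet) (W : set Out).
Hypotheses (oD : copen D) (D0 : D xi0) (sphi : forall j, fsmooth D (phi j))
  (DUf : forall z, D z -> Uf (input_point ol z)).
Hypotheses (oW : copen W) (DW : forall z, D z -> W (Phi z))
  (sFx : forall i, fsmooth W (Fx i)) (sFu : forall j, fsmooth W (Fu j)).
Hypotheses (param_x : forall z i, D z -> z (inl i) = Fx i (Phi z))
  (param_u : forall z j, D z -> z (inr (0%N, j)) = Fu j (Phi z)).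

(** An enumeration of the slots y_[0,kappa-1]. Its order is left open, as invertibility of [J] is
    insensitive to a permutation of the columns. *)
Variable c : 'I_n -> nat * 'I_m.
Hypotheses (c_inj : injective c)
  (codom_c : forall e, (e \in codom c) = (e.1 < kappa e.2)%N).

Let J := \matrix_(i < n, k < n) partial (c k) (Fx i) (Phi xi0).

Lemma fsmooth_ol U j : fsmooth U (ol j).
Proof. exact: fsmooth_coord. Qed.

Lemma smap_Phi : smap D Phi.
Proof.
by move=> e; apply: (fsmooth_iter oUf sf e.1 oD (fun j => fsmooth_ol D j)).
Qed.

Lemma smooth_feedback la alpha ws :
  (forall j, smooth_at (@up_to_order n m la) (constant_jet xs ws) (alpha j)) ->
  (forall j, alpha j (constant_jet xs ws) = us j) ->
  exists U, [/\ copen U, U (constant_jet xs ws), forall j, fsmooth U (alpha j) &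
    forall z, U z -> Uf (input_point alpha z)].
Proof.
move=> sa aus.
have [U [oU U0 sU]] := smooth_at_family
  (fun e => etrans (esym (jet_seqP la e)) : _ -> _) sa.
exists (admissible Uf alpha U); split.
- exact: admissible_open.
- by split => //; rewrite (input_point_constant aus).
- by move=> j; apply: fsmooth_sub (sU j) => z [].
- by move=> z [].
Qed.

Lemma closed_loop_constant alpha ws :
  (forall j, alpha j (constant_jet xs ws) = us j) ->
  prolong f alpha alpha (constant_jet xs ws) = xi0.
Proof.
move=> aus; rewrite (prolong_constant equil _ aus).
by congr constant_jet; apply/funext => j.
Qed.

(* In closed loop x = Fx(y_[0,kappa-1], w, w_[1], ...), where only y_[0,kappa-1]
   depends on x; differentiating by x gives a right inverse of the Jacobian. *)
Lemma introducible_unitmx :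
  introducible_as_input f xs us phi kappa -> J \in unitmx.
Proof.
move=> [alpha [ws [[[la sa] aus _] io]]].
set zeta0 := constant_jet xs ws in sa aus io.
have [U [oU U0 sU UUf]] := smooth_feedback sa aus.
pose A : Jet -> Jet := prolong f alpha alpha.
have A0 : A zeta0 = xi0 by exact: closed_loop_constant.
have sA : smap U A by exact: (smap_prolong oUf sf).
pose Y := [set z | U z /\ D (A z)].
have oY : copen Y by exact: copen_preim.
have sAY : smap Y A by apply: smap_sub sA => z [].
have [L [oL L0 Lio]] := cnbhs_open ((nearP _ _).1 io).
have oYL : copen (Y `&` L) by exact: copenI.
have Y0 : (Y `&` L) zeta0 by split => //; split => //; rewrite A0.
(* From order kappa^j on, the closed-loop output y^j and its derivatives are w^j and its
   derivatives, as seen by splitting the order [k] into [k - kappa j] and [kappa j]. *)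
have PhiA z e : (Y `&` L) z -> e \notin codom c ->
    Phi (A z) e = z (inr ((e.1 - kappa e.2)%N, e.2)).
  case: e => k j [Yz Lz]; rewrite codom_c -leqNgt /= => kj.
  rewrite /Phi /output_map /= -{1}(subnK kj).
  have sUY i : fsmooth Y (alpha i) by apply: fsmooth_sub (sU i) => y [].
  rewrite -(iter_prolong (a := alpha) oUf sf _ oY oD sAY _ (fun j => fsmooth_ol D j)
    DUf _ (sphi j) Yz) //; last by move=> y [].
  rewrite iterD (iter_congr f alpha (G := fun z => z (inr (0%N, j))) _ oYL) //.
    by rewrite iter_coord.
  by move=> y [_ /Lio]; exact.
have sPA : smap Y (fun z => Phi (A z)).
  by apply: (smap_comp oY oD _ sAY smap_Phi) => z [].
have [Y00 _] := Y0.
have dPA i j := fsmooth_pderivable (i := i) (sPA j) Y00.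
suff JX : J *m (\matrix_(k, l) partial (inl l) (fun z => Phi (A z) (c k)) zeta0) = 1%:M.
  by have [] := mulmx1_unit JX.
apply/matrixP => i l; rewrite !mxE.
transitivity (partial (inl l) (fun z : Jet => z (inl i)) zeta0); last first.
  by rewrite partial_coord /= eq_sym.
transitivity (partial (inl l) (fun z : Jet => Fx i (Phi (A z))) zeta0); last first.
  apply: (partial_congr (inl l) oY _ Y00) => z [_ DAz].
  by rewrite -param_x.
have [_ [s0 dep0]] := sFx i.
(* Putting [codom c] first splits the chain rule sum into an entry of the matrix product and the
   slots occupied by w, w_[1], ..., whose derivatives by x are zero. *)
pose s := codom c ++ [seq e <- undup s0 | e \notin codom c].
have us' : uniq s.
  rewrite cat_uniq filter_uniq ?undup_uniq// andbT; apply/andP; split.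
    exact/injectiveP.
  by apply/hasPn => e; rewrite mem_filter => /andP[].
have dep : depends_only_on (fun e => e \in s) W (Fx i).
  apply: depends_sub dep0 => // e es; rewrite mem_cat mem_filter mem_undup es andbT.
  by case: (e \in codom c).
have WPA : W (Phi (A zeta0)) by rewrite A0; exact: DW.
have [_ ->] := partial_comp (T := fun z => Phi (A z)) oW ((sFx i).1 1%N) us' dep WPA (dPA (inl l)).
rewrite big_cat/= [X in _ = _ + X]big1_seq ?addr0; last first.
  move=> e /andP[_]; rewrite mem_filter => /andP[ec _].
  have -> : partial (inl l) (fun z => Phi (A z) e) zeta0 =
      partial (inl l) (fun z : Jet => z (inr ((e.1 - kappa e.2)%N, e.2))) zeta0.
    by apply: (partial_congr (inl l) oYL _ Y0) => z YLz; exact: PhiA.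
  by rewrite partial_coord mulr0.
rewrite /codom big_image; apply: eq_bigr => k _.
by rewrite A0 !mxE.
Qed.

(* Coordinates (x, w, w_[1], ...) of the closed loop read as output coordinates:
   x takes the slots y_[0,kappa-1] and w_[k] the slots y_[kappa+k]. *)
Definition to_out (z : Jet) : Out := fun e =>
  if [pick i | c i == e] is Some i then z (inl i)
  else z (inr ((e.1 - kappa e.2)%N, e.2)).

Definition of_out (eta : Out) : Jet := fun d =>
  match d with inl i => eta (c i) | inr (k, j) => eta ((k + kappa j)%N, j) end.

Lemma of_outK eta : to_out (of_out eta) = eta.
Proof.
apply/funext => -[k j]; rewrite /to_out; case: pickP => [i /eqP <- //|nc] /=.
rewrite subnK// leqNgt -[(k < _)%N](codom_c (k, j)); apply/negP => /codomP[i e].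
by have := nc i; rewrite e eqxx.
Qed.

Lemma to_outK z : of_out (to_out z) = z.
Proof.
apply/funext => -[i|[k j]]; rewrite /= /to_out; case: pickP => [i' /eqP|nc].
- by move=> /c_inj ->.
- by have := nc i; rewrite eqxx.
- by move=> e; have := codom_f c i'; rewrite e codom_c /= ltnNge leq_addl.
- by rewrite /= addnK.
Qed.

Lemma smap_to_out U : smap U to_out.
Proof. by move=> e; rewrite /to_out; case: pickP => [i|] _; exact: fsmooth_coord. Qed.

Lemma smap_of_out U : smap U of_out.
Proof. by move=> [i|[k j]]; exact: fsmooth_coord. Qed.

Hypothesis indep : forall beta (a : 'I_beta.+1 * 'I_m -> R),
  (forall d, \sum_e a e * partial d (fun z => Phi z (val e.1, e.2)) xi0 = 0) ->
  forall e, a e = 0.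

(** [Phi] is matched on a finite list only: the radius from [local_surjection] depends on the bound
    [beta] of the orders involved. *)
Lemma output_surjection V (s : seq (nat * 'I_m)) : copen V -> V xi0 ->
  cnbhs (Phi xi0) [set eta | exists2 z, V z & forall e, e \in s -> Phi z e = eta e].
Proof.
move=> oV V0.
have [beta sb] : exists beta, forall e, e \in s -> (e.1 <= beta)%N.
  exists (\max_(e <- s) e.1)%N => e es; by apply: leq_bigmax_seq.
have [e [e0 h]] := local_surjection
  (g := fun (e : 'I_beta.+1 * 'I_m) z => Phi z (val e.1, e.2)) oD
  (fun _ => smap_Phi _) D0 oV V0 (@indep beta).
exists [seq (val e.1, e.2) | e <- enum {: 'I_beta.+1 * 'I_m}], e; split => // eta etas.
have [|z [Vz Phiz]] := h (fun e => eta (val e.1, e.2)).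
  by move=> k; apply: etas; apply: map_f; rewrite mem_enum.
exists z => // -[k j] /sb /= kb.
by have := Phiz (Ordinal (kb : (k < beta.+1)%N), j).
Qed.

(* With T replacing y_[0,kappa-1] by x, the map B from (x, u, u_[1], ...) to
   (x, w, w_[1], ...) is T o Phi, and alpha inverts it on the left. That alpha also
   inverts B on the right needs the local surjectivity of Phi. *)
Lemma unitmx_introducible :
  J \in unitmx -> introducible_as_input f xs us phi kappa.
Proof.
move=> uJ.
pose T (eta : Out) : Out := override c (fun k => Fx k eta) eta.
have [U [V [S [U0 [[oU oV sT sS] [UV VU ST TS]]]]]] : local_diffeo T (Phi xi0).
  exact: (inverse_function c_inj oW sFx (DW D0) uJ).
pose alpha (j : 'I_m) (z : Jet) := Fu j (S (to_out z)).
pose beta (j : 'I_m) (z : Jet) := Phi z (kappa j, j).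
pose B : Jet -> Jet := prolong f ol beta.
have BT z : D z -> B z = of_out (T (Phi z)).
  move=> Dz; apply/funext => -[i|[k j]].
    by rewrite /T /= override_in// -param_x.
  rewrite /= /T override_out; last by rewrite codom_c /= ltnNge leq_addl.
  by rewrite /Phi /output_map /= iterD.
have sbeta j : fsmooth D (beta j) by exact: smap_Phi.
have sB : smap D B by exact: (smap_prolong oUf sf oD (fun j => fsmooth_ol D j)).
have alphaB z j : D z -> U (Phi z) -> alpha j (B z) = z (inr (0%N, j)).
  by move=> Dz Uz; rewrite /alpha BT// of_outK ST// -param_u.
pose ws j := beta j xi0.
pose zeta0 : Jet := constant_jet xs ws.
have B0 : B xi0 = zeta0 by rewrite /B (prolong_constant equil _ (us := us)).
pose Va : set Jet := [set z | V (to_out z) /\ W (S (to_out z))].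
have oVto : copen [set z : Jet | True /\ V (to_out z)].
  exact: (copen_preim (@copenT R _) oV (smap_to_out setT)).
have sSto : smap [set z : Jet | True /\ V (to_out z)] (fun z => S (to_out z)).
  by apply: (smap_comp oVto oV _ (smap_to_out _) sS) => z [].
have oVa : copen Va.
  have := copen_preim oVto oW sSto; congr copen.
  by apply/seteqP; split => z /= => [[[_ ?] ?]|[? ?]].
have to0 : to_out zeta0 = T (Phi xi0) by rewrite -B0 BT// of_outK.
have Va0 : Va zeta0 by rewrite /Va /= to0 ST//; split; [exact: UV|exact: DW].
have sa j : fsmooth Va (alpha j).
  apply: (fsmooth_comp oVa oW _ _ (sFu j)) => [z []//|].
  by apply: smap_sub sSto => z [].
have aus j : alpha j zeta0 = us j by rewrite -B0 alphaB.
have [la dla] : exists la, forall j, depends_only_on (@up_to_order n m la) Va (alpha j).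
  have [s dep] := @smap_depends R _ _ Va (fun z j => alpha j z) (enum 'I_m) sa.
  have [l sl] := finite_order s; exists l => j x y Vx Vy xy.
  by apply: dep => //; [move=> d /sl; exact: xy|rewrite mem_enum].
have sma j : smooth_at (@up_to_order n m la) zeta0 (alpha j).
  exact: fsmooth_smooth_at oVa Va0 (sa j) (dla j).
have [lb dlb] : exists lb, forall j, depends_only_on (@up_to_order n m lb) D (beta j).
  have [s dep] := @smap_depends R _ _ D (fun z j => beta j z) (enum 'I_m) sbeta.
  have [l sl] := finite_order s; exists l => j x y Vx Vy xy.
  by apply: dep => //; [move=> d /sl; exact: xy|rewrite mem_enum].
pose Ya := admissible Uf alpha Va.
have oYa : copen Ya by exact: admissible_open.
have Ya0 : Ya zeta0 by split => //; rewrite (input_point_constant aus).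
have saY j : fsmooth Ya (alpha j) by apply: fsmooth_sub (sa j) => z [].
have YaU z : Ya z -> Uf (input_point alpha z) by case.
pose A : Jet -> Jet := prolong f alpha alpha.
have sA : smap Ya A by exact: (smap_prolong oUf sf).
have A0 : A zeta0 = xi0 by exact: closed_loop_constant.
pose Y := [set z | Ya z /\ D (A z)].
have oY : copen Y by exact: copen_preim.
have Y0 : Y zeta0 by split => //; rewrite A0.
have sAY : smap Y A by apply: smap_sub sA => z [].
pose X0 := [set z | D z /\ U (Phi z)].
have oX0 : copen X0 by exact: copen_preim smap_Phi.
have sBX : smap X0 B by apply: smap_sub sB => z [].
pose X := [set z | X0 z /\ Y (B z)].
have oX : copen X by exact: copen_preim.
have X00 : X xi0 by split; [split|rewrite B0].
(* [alphaB] recovers u alone; since prolongations commute with time differentiation, it recovers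
   every u_[k] as well. *)
have AB z : X z -> A (B z) = z.
  move=> Xz; apply/funext => -[i|[k j]] //=.
  have sBX' : smap X B by apply: smap_sub sBX => y [].
  rewrite -(iter_prolong (a := ol) (D := X) oUf sf _ oX oYa sBX' _ saY YaU _ (saY j) Xz);
    [|by move=> y [_ []]|by move=> y l [[Dy Uy] _]; rewrite alphaB].
  rewrite (iter_congr f ol (G := fun y => y (inr (0%N, j))) _ oX)//.
    by rewrite iter_coord.
  by move=> y [[Dy Uy] _]; rewrite alphaB.
(* On the image of [B] the identity follows from [AB]. A general [z] is replaced by some [B y]
   agreeing with it on the finitely many coordinates that enter the two sides. *)
have betaA : cnbhs zeta0 [set z | Y z /\ forall j, beta j (A z) = z (inr (0%N, j))].
  have sbA j : fsmooth Y (fun z => beta j (A z)).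
    by apply: (fsmooth_comp oY oD _ sAY (sbeta j)) => z [].
  have [s dep] := @smap_depends R _ _ Y (fun z j => beta j (A z)) (enum 'I_m) sbA.
  pose s' := s ++ [seq inr (0%N, j) | j <- enum 'I_m].
  have sOT : smap U (fun eta => of_out (T eta)).
    exact: (smap_comp oU (@copenT R _) _ sT (smap_of_out setT)).
  (* [q] lists the output slots that determine the coordinates [s'], so matching [Phi y] with
     [S (to_out z)] on [q] matches [B y] with [z] on [s']. *)
  have [q depq] := smap_depends s' sOT.
  have near_eta := output_surjection q oX X00.
  have cS : ccvg (fun z => S (to_out z)) (cnbhs zeta0) (Phi xi0).
    have := smap_ccvg sSto (conj I Va0.1); rewrite to0 ST//.
  have near_z : cnbhs zeta0 [set z | exists2 y, X y &
      forall e, e \in q -> Phi y e = S (to_out z) e].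
    exact: (ccvg_near cS near_eta).
  apply: filterS (filterI (oY _ Y0) near_z) => z [Yz [y Xy yz]]; split => // j.
  have [[Dy Uy] YBy] := Xy.
  have Vz : V (to_out z) by have [[[]]] := Yz.
  have Bz d : d \in s' -> B y d = z d.
    by move=> ds; rewrite BT// (depq _ _ Uy (VU _ Vz) yz d ds) TS// to_outK.
  have -> : beta j (A z) = beta j (A (B y)).
    apply: dep; rewrite ?mem_enum// => d ds.
    by rewrite Bz// mem_cat ds.
  rewrite AB// -Bz ?mem_cat ?map_f ?mem_enum ?orbT//.
exists alpha, ws; split.
  split; [by exists la|exact: aus|exists lb, beta; split].
  - by move=> j; exact: fsmooth_smooth_at oD D0 (sbeta j) (dlb j).
  - by apply/nearP; apply: filterS betaA => z [].
  - apply/nearP; apply: filterS (oX0 _ _) => [z [Dz Uz] j|]; first exact: alphaB.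
    by split.
apply/nearP; apply: filterS betaA => z [Yz bA] j.
(* By [iter_prolong], the closed-loop derivative of order kappa^j of y^j is [beta j (A z)], so the
   linear behavior is [betaA] read again. *)
rewrite -bA /beta /Phi /output_map /=.
have sUY i : fsmooth Y (alpha i) by apply: fsmooth_sub (saY i) => y [].
apply: (iter_prolong (a := alpha) oUf sf _ oY oD sAY _ (fun j => fsmooth_ol D j)
    DUf _ (sphi j) Yz) => //.
by move=> y [].
Qed.

End Flatness.

(** * Regularity near the equilibrium and the equivalence *)

Lemma unitmx_near (R : realType) (I : eqType) (n : nat) (U : set (coord_space R I))
    (g : 'I_n -> 'I_n -> coord_space R I -> R) x :
  copen U -> (forall i k, fsmooth U (g i k)) -> U x ->
  \matrix_(i, k) g i k x \in unitmx ->
  cnbhs x [set y | \matrix_(i, k) g i k y \in unitmx].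
Proof.
move=> oU sg Ux; rewrite unitmxE unitfE => d0.
have sd : fsmooth U (fun y => \det (\matrix_(i, k) g i k y)).
  apply: fsmooth_sum => // s _; apply: fsmoothM => //; first exact: fsmooth_cst.
  apply: fsmooth_prod => // i _.
  by apply: (fsmooth_congr oU _ (sg i _)) => y _; rewrite mxE.
have {}d0 : cnbhs x [set y | \det (\matrix_(i, k) g i k y) != 0].
  exact: cvgr_neq0 (fsmooth_cvg sd Ux) d0.
by apply: filterS d0 => y /=; rewrite unitmxE unitfE.
Qed.

Lemma below_seq (m : nat) (r : 'I_m -> nat) b (e : nat * 'I_m) : below r b e ->
  e \in [seq (k, j) | k <- iota 0 (\max_(j < m) r j).+1, j <- enum 'I_m].
Proof.
case: e => k j kr; apply/allpairsPdep; exists k, j.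
rewrite mem_enum mem_iota ltnS; split => //.
exact: leq_trans (leq_trans (leq_addr b k) kr) (leq_bigmax j).
Qed.

Section SlotOrder.
Variables (p m : nat) (kappa : 'I_m -> nat).
Hypothesis (kappa_sum : (\sum_(j < m) kappa j)%N = (p + p)%N).

(** [\mxrow] numbers its columns by [tagnat]; reading derivative order and output index off that
    numbering makes the two Jacobians agree entry by entry. *)
Definition slot (k : 'I_(p + p)) : nat * 'I_m :=
  let s := cast_ord (esym kappa_sum) k in (val (tagnat.sig2 s), tagnat.sig1 s).

Lemma slot_inj : injective slot.
Proof.
move=> k l [e2 e1]; apply: (@cast_ord_inj _ _ (esym kappa_sum)).
rewrite -[LHS]tagnat.sig2K -[RHS]tagnat.sig2K; apply/eqP.
rewrite -(inj_eq val_inj) tagnat.eq_Rank; apply/andP; split; apply/eqP => //.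
Qed.

Lemma codom_slot e : (e \in codom slot) = (e.1 < kappa e.2)%N.
Proof.
apply/codomP/idP => [[k ->]|]; first exact: ltn_ord.
case: e => k j /= kj; exists (cast_ord kappa_sum (tagnat.Rank j (Ordinal kj))).
rewrite /slot cast_ordK tagnat.Rank2K /= tagnat.Rank1K //.
Qed.

End SlotOrder.

Lemma output_jacobianE (R : realType) (p m : nat) (Fq Fv : 'I_p -> output_jet R m -> R)
    (kappa : 'I_m -> nat) (kappa_sum : (\sum_(j < m) kappa j)%N = (p + p)%N)
    (eta : output_jet R m) :
  castmx (erefl (p + p)%N, kappa_sum)
    (col_mx (output_jacobian kappa Fq eta) (output_jacobian kappa Fv eta)) =
  \matrix_(i, k) partial (slot kappa_sum k) (stack Fq Fv i) eta.
Proof.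
apply/matrixP => i k; rewrite castmxE !mxE /stack cast_ord_id.
by case: fintype.splitP => l il; rewrite !mxE.
Qed.

Theorem proposition4 (R : realType) (p m : nat)
    (M : coord_space R 'I_p -> 'M[R]_p) (V : coord_space R 'I_p -> R)
    (G : coord_space R 'I_p -> 'M[R]_(p, m))
    (f : 'I_p -> state_input R (p + p) m -> R)
    (xs : 'I_(p + p) -> R) (us : 'I_m -> R)
    (lu : nat) (phi : 'I_m -> jet R (p + p) m -> R) (r : 'I_m -> nat)
    (Fq Fv : 'I_p -> output_jet R m -> R) (Fu : 'I_m -> output_jet R m -> R)
    (kappa : 'I_m -> nat)
    (system : lagrangian_control_system M V G f xs us)
    (equil : equilibrium (second_order f) xs us)
    (flat : flat_output (second_order f) xs us lu phi r (stack Fq Fv) Fu)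
    (Fq_order : forall i, smooth_at (below r 2)
       (output_map (second_order f) phi (constant_jet xs us)) (Fq i))
    (kappa_le : forall j, (kappa j <= r j)%N)
    (kappa_sum : (\sum_(j < m) kappa j)%N = (p + p)%N) :
  introducible_as_input (second_order f) xs us phi kappa <->
  (\forall eta \near output_map (second_order f) phi (constant_jet xs us),
     castmx (erefl (p + p)%N, kappa_sum)
       (col_mx (output_jacobian kappa Fq eta) (output_jacobian kappa Fv eta)) \in unitmx).
Proof.
have [_ _ _ sf _] := system.
have [sphi indep [[sFx sFu px pu] _]] := flat.
set g := second_order f in equil indep sFx sFu px pu *.
set Fx := stack Fq Fv in sFx px.
set xi0 := constant_jet xs us in sphi indep sFx sFu px pu *.
have sg i : smooth_at xpredT (pair_point xs us) (g i).
  rewrite /g /second_order /stack; case: fintype.split => k; last exact: sf.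
  apply: (fsmooth_smooth_at (U := setT)); [exact: copenT|by []|exact: fsmooth_coord|].
  by move=> x y _ _ ->.
have [Uf [oUf Uf0 sgU]] := smooth_at_family (s := enum {: 'I_(p + p) + 'I_m})
  (fun e _ => mem_enum _ e) sg.
have [D1 [oD1 D10 sD1]] := smooth_at_family
  (fun e => etrans (esym (jet_seqP lu e)) : _ -> _) sphi.
have [W1 [oW1 W10 sW1]] := smooth_at_family (@below_seq m r 1) sFx.
have [W2 [oW2 W20 sW2]] := smooth_at_family (@below_seq m r 0) sFu.
have [L1 [oL1 L10 sL1]] := cnbhs_open ((nearP _ _).1 px).
have [L2 [oL2 L20 sL2]] := cnbhs_open ((nearP _ _).1 pu).
pose ol := @open_loop R (p + p) m.
have sol U j : fsmooth U (ol j) by exact: fsmooth_coord.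
pose D2 := admissible Uf ol D1.
have oD2 : copen D2 by exact: admissible_open.
have D20 : D2 xi0.
  by split => //; rewrite (input_point_constant (us := us)).
have sD2 : smap D2 (output_map g phi).
  apply: (smap_Phi oUf sgU oD2); first by move=> j; apply: fsmooth_sub (sD1 j) => z [].
  by move=> z [].
(* One set on which the dynamics and [phi] are smooth, the output jet lies where [Fx] and [Fu] are
   smooth, and both parameterization identities hold. *)
pose D := [set z | D2 z /\ (W1 `&` W2) (output_map g phi z)] `&` (L1 `&` L2).
have oW : copen (W1 `&` W2) by exact: copenI.
have oD : copen D by apply: copenI; [exact: copen_preim sD2|exact: copenI].
have D0 : D xi0 by split; split.
have DD1 : D `<=` D1 by move=> z [[[]]].
have DUf z : D z -> Uf (input_point ol z) by move=> [[[]]].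
have DW z : D z -> (W1 `&` W2) (output_map g phi z) by move=> [[]].
have sphiD j : fsmooth D (phi j) by exact: fsmooth_sub DD1 (sD1 j).
have sFxW i : fsmooth (W1 `&` W2) (Fx i) by apply: fsmooth_sub (sW1 i) => z [].
have sFuW j : fsmooth (W1 `&` W2) (Fu j) by apply: fsmooth_sub (sW2 j) => z [].
have pxD z i : D z -> z (inl i) = Fx i (output_map g phi z).
  by move=> [_ [Lz _]]; exact: sL1.
have puD z j : D z -> z (inr (0%N, j)) = Fu j (output_map g phi z).
  by move=> [_ [_ Lz]]; exact: sL2.
have indep0 beta (a : 'I_beta.+1 * 'I_m -> R) :
    (forall d, \sum_e a e *
      partial d (fun z => output_map g phi z (val e.1, e.2)) xi0 = 0) ->
    forall e, a e = 0.
  move=> a0 e; have := cnbhs_self ((nearP _ _).1 (indep beta)).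
  move=> /(_ (\matrix_(k, j) a (k, j))) a1.
  have /matrixP/(_ e.1 e.2) : \matrix_(k < beta.+1, j < m) a (k, j) = 0.
    apply: a1 => d; rewrite -[RHS](a0 d) pair_big /=.
    by apply: eq_bigr => -[k j] _; rewrite mxE.
  by rewrite !mxE -surjective_pairing.
have -> : (\forall eta \near output_map g phi xi0,
     castmx (erefl (p + p)%N, kappa_sum)
       (col_mx (output_jacobian kappa Fq eta) (output_jacobian kappa Fv eta)) \in unitmx) =
  cnbhs (output_map g phi xi0)
    [set eta | \matrix_(i, k) partial (slot kappa_sum k) (Fx i) eta \in unitmx].
  rewrite -nbhs_coordE; congr nbhs; apply/funext => eta.
  by rewrite output_jacobianE.
have ci := @slot_inj p m kappa kappa_sum.
have cc := @codom_slot p m kappa kappa_sum.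
(* The equivalence is obtained at the equilibrium itself; continuity of the determinant spreads
   regularity to a neighbourhood. *)
split=> [intro|/cnbhs_self uJ].
  apply: (unitmx_near (U := W1 `&` W2)
    (g := fun i k => partial (slot kappa_sum k) (Fx i)) oW) => [i k||].
  - exact: fsmooth_partial.
  - exact: DW.
  exact: (introducible_unitmx oUf sgU equil Uf0 oD D0 sphiD DUf oW DW sFxW pxD ci cc intro).
exact: (unitmx_introducible oUf sgU equil Uf0 oD D0 sphiD DUf oW DW sFxW sFuW pxD puD ci cc
  indep0 uJ).
Qed.
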